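(* Let $n\ge 1$ and $\mu,\mu_c,\kappa>0$. Let $A,B\in\mathrm{GL}^+(n)$. Then there exists a length minimizing curve connecting $A$ and $B$, i.e. $X\in\mathcal{A}_A^B$ with $L(X)=\mathrm{dist}_{\mathrm{geod}}(A,B)$.
   Context: $\mathrm{GL}(n)$ (resp. $\mathrm{GL}^+(n)$) is the set of real $n\times n$ matrices with nonzero (resp. positive) determinant. For $M\in\mathbb{R}^{n\times n}$: $\mathrm{sym}\,M=\tfrac12(M+M^T)$, $\mathrm{skew}\,M=\tfrac12(M-M^T)$, $\mathrm{dev}\,M=M-\frac{\mathrm{tr}\,M}{n}I$, and $\langle M,N\rangle=\mathrm{tr}(M^TN)$. For $\mu,\mu_c,\kappa>0$ put $$\langle M,N\rangle_{\mu,\mu_c,\kappa}=\mu\langle\mathrm{dev}\,\mathrm{sym}\,M,\mathrm{dev}\,\mathrm{sym}\,N\rangle+\mu_c\langle\mathrm{skew}\,M,\mathrm{skew}\,N\rangle+\tfrac{\kappa}{n}(\mathrm{tr}\,M)(\mathrm{tr}\,N),$$ and let $g$ be the Riemannian metric on $\mathrm{GL}(n)$ given by $g_A(M,N)=\langle A^{-1}M,A^{-1}N\rangle_{\mu,\mu_c,\kappa}$. The length of a piecewise continuously differentiable curve $X\colon[a,b]\to\mathrm{GL}(n)$ is $L(X)=\int_a^b\sqrt{g_{X(t)}(\dot X(t),\dot X(t))}\,dt$. $\mathcal{A}_A^B$ is the set of all continuous curves $Y\colon[a,b]\to\mathrm{GL}(n)$ ($a<b$ arbitrary) with $Y(a)=A$,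 $Y(b)=B$ for which there is a partition $a=a_0<a_1<\dots<a_{m+1}=b$ such that each $Y|_{[a_j,a_{j+1}]}$ is continuously differentiable (one-sided at endpoints) with nowhere vanishing derivative. The geodesic distance is $\mathrm{dist}_{\mathrm{geod}}(A,B)=\inf_{Y\in\mathcal{A}_A^B}L(Y)$.
   Formalization: For A = B no minimizer exists in the class, since its curves have nowhere vanishing derivative, hence positive length, while the distance is 0; the claim is therefore proved for A ≠ B, and for A = B it is shown instead that the constant curve has length equal to the distance. *)

(* Defs.v *)
From HB Require Import structures.
From mathcomp Require Import all_boot all_order all_algebra.
From mathcomp Require Import all_classical all_reals all_analysis.

Set Implicit Arguments.
Unset Strict Implicit.
Unset Printing Implicit Defensive.

Import Order.TTheory GRing.Theory Num.Theory.
Import numFieldNormedType.Exports.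

Local Open Scope classical_set_scope.
Local Open Scope ring_scope.

Definition GL (R : realType) (n : nat) : set 'M[R]_n := [set M | \det M != 0].

Definition GLplus (R : realType) (n : nat) : set 'M[R]_n := [set M | 0 < \det M].

Definition sym_part (R : realType) (n : nat) (M : 'M[R]_n) : 'M[R]_n :=
  2^-1 *: (M + M^T).

Definition skew_part (R : realType) (n : nat) (M : 'M[R]_n) : 'M[R]_n :=
  2^-1 *: (M - M^T).

Definition dev_part (R : realType) (n : nat) (M : 'M[R]_n) : 'M[R]_n :=
  M - (\tr M / n%:R)%:M.

Definition frob (R : realType) (n : nat) (M N : 'M[R]_n) : R :=
  \tr (M^T *m N).

Definition iso_inner (R : realType) (n : nat) (mu muc kappa : R)
    (M N : 'M[R]_n) : R :=
  mu * frob (dev_part (sym_part M)) (dev_part (sym_part N))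
  + muc * frob (skew_part M) (skew_part N)
  + kappa / n%:R * (\tr M * \tr N).

Definition riem_metric (R : realType) (n : nat) (mu muc kappa : R)
    (A M N : 'M[R]_n) : R :=
  iso_inner mu muc kappa (invmx A *m M) (invmx A *m N).

(* Curves on [a, b] are total functions on R of which only the restriction to
   [a, b] matters. For a piecewise C^1 curve the two-sided derivative derive1 X is
   the true derivative except at finitely many points (the break points and a,
   b), which form a null set. *)
Definition curve_length (R : realType) (n : nat) (mu muc kappa a b : R)
    (X : R -> 'M[R]_n) : \bar R :=
  (\int[lebesgue_measure]_(t in `[a, b])
    (Num.sqrt (riem_metric mu muc kappa (X t) (derive1 X t) (derive1 X t)))%:E)%E.

(* The limit along `within [c, d] t^'` is the two-sided derivative for t in
   ]c, d[ and the one-sided derivative at c and at d. *)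
Definition regular_C1 (R : realType) (n : nat) (c d : R)
    (Y : R -> 'M[R]_n) : Prop :=
  exists D : R -> 'M[R]_n,
    [/\ forall t, t \in `[c, d] ->
          (s - t)^-1 *: (Y s - Y t) @[s --> within `[c, d] t^'] --> D t,
        {within `[c, d], continuous D}
      & forall t, t \in `[c, d] -> D t != 0].

(* The break points of the partition are a :: s, where the last element of s
   is b. *)
Definition admissible (R : realType) (n : nat) (A B : 'M[R]_n) (a b : R)
    (Y : R -> 'M[R]_n) : Prop :=
  [/\ a < b, Y a = A /\ Y b = B,
      forall t, t \in `[a, b] -> GL (Y t),
      {within `[a, b], continuous Y}
    & exists2 s : seq R, itv_partition a b s &
        forall j : nat, (j < size s)%N ->
          regular_C1 (nth b (a :: s) j) (nth b (a :: s) j.+1) Y].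

Definition geod_dist (R : realType) (n : nat) (mu muc kappa : R)
    (A B : 'M[R]_n) : \bar R :=
  ereal_inf [set l | exists a b Y,
    admissible A B a b Y /\ l = curve_length mu muc kappa a b Y].

(* Main.v *)
Require Import Defs.
From HB Require Import structures.
From mathcomp Require Import all_boot all_order all_algebra all_fingroup.
From mathcomp Require Import all_classical all_reals all_analysis.
From mathcomp Require Import measurable_realfun ring lra.

Set Implicit Arguments.
Unset Strict Implicit.
Unset Printing Implicit Defensive.

Import Order.TTheory GRing.Theory Num.Theory.
Import numFieldNormedType.Exports.

Local Open Scope classical_set_scope.
Local Open Scope ring_scope.

(* A minimizer is obtained by the direct method, without geodesic equation,
   exponential map or Gauss lemma.  Write N for the norm of the metric at 1 and
   step x y = N (x^-1 y - 1).  Lengths are replaced by the costs (sums of steps)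
   of fine chains of matrices; reach L x y says that there are arbitrarily fine
   chains from x to y of cost at most L + o(1).
   - Every admissible curve of length L yields reach L, by Cousin's lemma; and
     reach L A B holds for some L because GL+ is connected (LU decomposition).
   - Let l be the least L with reach L A B.  Sampling ever finer almost optimal
     chains and passing to the limit along an ultrafilter (Heine-Borel) gives a
     curve X on [0, l] with 1 + c step (X s) (X t) <= exp (c (t - s)).
     Replacing a piece of X by a straight segment would shorten it otherwise, so
     minimality gives step (X s) (X t) = (t - s) + O((t - s)^2).
   - Thus chords of X are almost additive in length, and the parallelogram
     identity forces two consecutive chords in an interval of length h to have
     slopes differing by O(sqrt h).  Summing over geometric scales, the
     difference quotients converge uniformly: X is C^1, with unit speed, so it
     is admissible and its length is l. *)

(** * The inner product on matrices *)

(** The metric is only left invariant, and [step] sees it only to first order: it is neither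
    symmetric nor subadditive. What replaces the triangle inequality is that [1 + c * step] is
    submultiplicative, so costs are compared through exponentials [expR (c * L)]. Such bounds are
    closed conditions and survive limits, whereas lengths need derivatives that a limit curve is not
    known to have. Backward steps are bounded too, which keeps chains and their inverses in a
    bounded set, so that the limit stays invertible. The lower bound on the steps of a minimal curve
    rests on the cost [r / (1 - c * r)] of a straight segment of step [r], which exceeds [r] only to
    second order. The inner product enters through bilinearity, symmetry, equivalence with the sup
    norm and submultiplicativity up to a constant; these form the record below. One constant [c]
    serves all three estimates, squared because they avoid square roots. *)

Record inner_norm (R : realType) (n : nat) := InnerNorm {
  inner :> 'M[R]_n -> 'M[R]_n -> R;
  icst : R;
  innerC : forall x y, inner x y = inner y x;
  innerDl : forall x y z, inner (x + y) z = inner x z + inner y z;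
  innerZl : forall a x y, inner (a *: x) y = a * inner x y;
  icst_ge1 : 1 <= icst;
  norm_le_inner : forall x, `|x| ^+ 2 <= icst ^+ 2 * inner x x;
  inner_le_norm : forall x, inner x x <= icst ^+ 2 * `|x| ^+ 2;
  inner_mul_le : forall x y,
    inner (x *m y) (x *m y) <= icst ^+ 2 * (inner x x * inner y y)
}.

Section mx_norm_facts.
Variables (R : realType) (n : nat).
Implicit Types M K : 'M[R]_n.

Lemma entry_le_norm M i j : `|M i j| <= `|M|.
Proof.
rewrite [leRHS]mx_normrE.
by apply: le_trans (le_bigmax _ _ (i, j)).
Qed.

Lemma norm_le_entries M (a : R) : 0 <= a -> (forall i j, `|M i j| <= a) -> `|M| <= a.
Proof.
move=> a0 h; rewrite [leLHS]mx_normrE; apply: bigmax_le => // ij _; exact: h.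
Qed.

Lemma norm_mulmx_le M K : `|M *m K| <= n%:R * (`|M| * `|K|).
Proof.
apply: norm_le_entries => [|i j]; first by rewrite !mulr_ge0.
rewrite mxE (le_trans (ler_norm_sum _ _ _)) //.
rewrite mulr_natl -[X in _ *+ X]card_ord -sumr_const ler_sum // => k _.
by rewrite normrM ler_pM // entry_le_norm.
Qed.

Lemma normr_mxtrace_le M : `|\tr M| <= n%:R * `|M|.
Proof.
rewrite /mxtrace (le_trans (ler_norm_sum _ _ _)) //.
rewrite mulr_natl -[X in _ *+ X]card_ord -sumr_const ler_sum // => k _.
exact: entry_le_norm.
Qed.

Lemma frobE M K : frob M K = \sum_i \sum_j M i j * K i j.
Proof.
rewrite /frob /mxtrace exchange_big; apply: eq_bigr => i _.
by rewrite mxE; apply: eq_bigr => j _; rewrite mxE.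
Qed.

Lemma entry2_le_frob M i j : M i j ^+ 2 <= frob M M.
Proof.
rewrite frobE (bigD1 i) //= (bigD1 j) //= -expr2 -addrA lerDl.
by rewrite addr_ge0 // sumr_ge0 // => k _; rewrite ?sumr_ge0 // => *; rewrite -expr2 sqr_ge0.
Qed.

Lemma frob_le_norm M (a : R) : 0 <= a -> (forall i j, `|M i j| <= a) ->
  frob M M <= n%:R ^+ 2 * a ^+ 2.
Proof.
move=> a0 h; rewrite frobE expr2 -mulrA mulr_natl -[X in _ *+ X]card_ord -sumr_const.
rewrite ler_sum // => i _.
rewrite mulr_natl -[X in _ *+ X]card_ord -sumr_const ler_sum // => j _.
by rewrite -expr2 -(ger0_norm (sqr_ge0 _)) normrX ler_pXn2r // nnegrE.
Qed.

Lemma frobC M K : frob M K = frob K M.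
Proof. by rewrite !frobE; do 2!apply: eq_bigr => ? _; rewrite mulrC. Qed.

Lemma frobDl M K L : frob (M + K) L = frob M L + frob K L.
Proof. by rewrite /frob linearD /= mulmxDl linearD. Qed.

Lemma frobZl a M K : frob (a *: M) K = a * frob M K.
Proof. by rewrite /frob linearZ /= -scalemxAl linearZ. Qed.

End mx_norm_facts.

Section iso_inner_norm.
Variables (R : realType) (n : nat) (mu muc kappa : R).
Hypotheses (n1 : (1 <= n)%N) (mu0 : 0 < mu) (muc0 : 0 < muc) (kappa0 : 0 < kappa).
Implicit Types M K : 'M[R]_n.
Local Notation ip := (@iso_inner R n mu muc kappa).

Lemma sym_partD M K : sym_part (M + K) = sym_part M + sym_part K.
Proof. by rewrite /sym_part [(M + K)^T]linearD /= -scalerDr addrACA. Qed.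

Lemma sym_partZ (a : R) M : sym_part (a *: M) = a *: sym_part M.
Proof. by rewrite /sym_part [(a *: M)^T]linearZ /= -scalerDr !scalerA mulrC. Qed.

Lemma skew_partD M K : skew_part (M + K) = skew_part M + skew_part K.
Proof. by rewrite /skew_part [(M + K)^T]linearD /= -scalerDr opprD addrACA. Qed.

Lemma skew_partZ (a : R) M : skew_part (a *: M) = a *: skew_part M.
Proof. by rewrite /skew_part [(a *: M)^T]linearZ /= -scalerBr !scalerA mulrC. Qed.

Lemma dev_partD M K : dev_part (M + K) = dev_part M + dev_part K.
Proof. by rewrite /dev_part [\tr _]linearD mulrDl raddfD /= opprD addrACA. Qed.

Lemma dev_partZ (a : R) M : dev_part (a *: M) = a *: dev_part M.
Proof. by rewrite /dev_part [\tr _]linearZ /= scalerBr scale_scalar_mx mulrA. Qed.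

Lemma iso_innerC M K : ip M K = ip K M.
Proof.
by rewrite /iso_inner frobC (frobC (skew_part _)) [\tr M * _]mulrC.
Qed.

Lemma iso_innerDl M K L : ip (M + K) L = ip M L + ip K L.
Proof.
rewrite /iso_inner sym_partD dev_partD skew_partD mxtraceD !frobDl; ring.
Qed.

Lemma iso_innerZl a M K : ip (a *: M) K = a * ip M K.
Proof.
rewrite /iso_inner sym_partZ dev_partZ skew_partZ mxtraceZ !frobZl; ring.
Qed.

Lemma frob_ge0 M : 0 <= frob M M.
Proof.
by rewrite frobE; do 2!(rewrite sumr_ge0 // => ? _); rewrite -expr2 sqr_ge0.
Qed.

(** [M] is the sum of [dev_part (sym_part M)], [skew_part M] and [(\tr M / n) I]. The inner product
    weighs the squared Frobenius norms [a], [b], [d] of these pieces by [mu], [muc], [kappa]; the 3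
    is Cauchy-Schwarz for a sum of three entries. *)
Lemma norm_le_iso_inner M :
  `|M| ^+ 2 <= 3 * (mu^-1 + muc^-1 + kappa^-1) * ip M M.
Proof.
have n0 : 0 < n%:R :> R by rewrite ltr0n.
set a := frob (dev_part (sym_part M)) (dev_part (sym_part M)).
set b := frob (skew_part M) (skew_part M).
set d := \tr M ^+ 2 / n%:R.
have a0 : 0 <= a by exact: frob_ge0.
have b0 : 0 <= b by exact: frob_ge0.
have d0 : 0 <= d by rewrite divr_ge0 ?sqr_ge0 // ltW.
have ipE : ip M M = mu * a + muc * b + kappa * d.
  by rewrite /iso_inner -/a -/b; congr (_ + _); rewrite /d -expr2 mulrAC -mulrA.
have key : a + b + d <= (mu^-1 + muc^-1 + kappa^-1) * ip M M.
  have iv (x : R) : 0 < x -> 0 <= x^-1 by move=> x0; rewrite invr_ge0 ltW.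
  have ia := iv _ mu0; have ib := iv _ muc0; have ik := iv _ kappa0.
  have ma : 0 <= mu * a by rewrite mulr_ge0 // ltW.
  have mb : 0 <= muc * b by rewrite mulr_ge0 // ltW.
  have md : 0 <= kappa * d by rewrite mulr_ge0 // ltW.
  have ha : a <= mu^-1 * ip M M by rewrite ler_pdivlMl // ipE; lra.
  have hb : b <= muc^-1 * ip M M by rewrite ler_pdivlMl // ipE; lra.
  have hd : d <= kappa^-1 * ip M M by rewrite ler_pdivlMl // ipE; lra.
  by rewrite !mulrDl !lerD.
rewrite -mulrA; apply: le_trans (ler_wpM2l _ key); last by [].
suff h i j : `|M i j| <= Num.sqrt (3 * (a + b + d)).
  have s0 : 0 <= 3 * (a + b + d) by rewrite mulr_ge0 // !addr_ge0.
  rewrite -(sqr_sqrtr s0) ler_pXn2r ?nnegrE ?sqrtr_ge0 //.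
  by apply: norm_le_entries => //; rewrite sqrtr_ge0.
rewrite -sqrtr_sqr; apply: ler_wsqrtr.
have := entry2_le_frob (dev_part (sym_part M)) i j; rewrite -/a.
have := entry2_le_frob (skew_part M) i j; rewrite -/b.
set x := skew_part M i j; set y := dev_part _ i j => hx hy.
have trs : \tr (sym_part M) = \tr M.
  by rewrite /sym_part linearZ /= linearD /= mxtrace_tr; field.
pose z := (\tr M / n%:R) *+ (i == j).
have -> : M i j = y + x + z.
  by rewrite /y /x /dev_part trs /sym_part /skew_part !mxE -/z; lra.
have hz : z ^+ 2 <= d.
  rewrite /z /d; case: (i == j); last by rewrite mulr0n expr0n.
  rewrite mulr1n expr_div_n ler_wpM2l ?sqr_ge0 // lef_pV2 ?posrE ?exprn_gt0 //.
  by rewrite expr2 ler_peMl // ?ler1n // ltW.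
have := sqr_ge0 (x - y); have := sqr_ge0 (x - z); have := sqr_ge0 (y - z); nra.
Qed.

(** Entries of the symmetric and skew parts are at most [|M|], those of the deviatoric part at most
    [2 |M|], and the trace at most [n |M|]; this produces the three summands. *)
Lemma iso_inner_le_norm M :
  ip M M <= (mu * n%:R ^+ 2 * 2 ^+ 2 + muc * n%:R ^+ 2 + kappa * n%:R) * `|M| ^+ 2.
Proof.
have n0 : 0 < n%:R :> R by rewrite ltr0n.
have hs i j : `|sym_part M i j| <= `|M|.
  rewrite /sym_part !mxE normrM ger0_norm ?invr_ge0 // ler_pdivrMl //.
  rewrite (le_trans (ler_normD _ _)) // mulr_natl mulr2n lerD //; exact: entry_le_norm.
have hk i j : `|skew_part M i j| <= `|M|.
  rewrite /skew_part !mxE normrM ger0_norm ?invr_ge0 // ler_pdivrMl //.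
  rewrite (le_trans (ler_normB _ _)) // mulr_natl mulr2n lerD //; exact: entry_le_norm.
have ht : `|\tr M| <= n%:R * `|M| by exact: normr_mxtrace_le.
have trs : \tr (sym_part M) = \tr M.
  by rewrite /sym_part linearZ /= linearD /= mxtrace_tr; field.
have hd i j : `|dev_part (sym_part M) i j| <= 2 * `|M|.
  have -> : dev_part (sym_part M) i j = sym_part M i j - (\tr M / n%:R) *+ (i == j).
    by rewrite /dev_part trs !mxE.
  rewrite (le_trans (ler_normB _ _)) // mulr_natl mulr2n lerD ?hs //.
  have -> : (\tr M / n%:R) *+ (i == j) = (i == j)%:R * (\tr M / n%:R).
    by rewrite mulr_natl.
  rewrite !normrM normfV !normr_nat mulrA.
  rewrite ler_pdivrMr // [leRHS]mulrC (le_trans _ ht) // ler_piMl //.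
  by case: (i == j).
rewrite /iso_inner !mulrDl; apply: lerD; first apply: lerD.
- apply: (@le_trans _ _ (mu * (n%:R ^+ 2 * (2 * `|M|) ^+ 2))).
    by rewrite ler_pM2l // frob_le_norm // mulr_ge0.
  by rewrite le_eqVlt; apply/orP; left; apply/eqP; ring.
- apply: (@le_trans _ _ (muc * (n%:R ^+ 2 * `|M| ^+ 2))).
    by rewrite ler_pM2l // frob_le_norm.
  by rewrite mulrA.
have : \tr M * \tr M <= (n%:R * `|M|) ^+ 2.
  by rewrite -expr2 -(ger0_norm (sqr_ge0 _)) normrX ler_pXn2r // nnegrE mulr_ge0.
move=> /(@ler_wpM2l _ (kappa / n%:R) (divr_ge0 (ltW kappa0) (ltW n0))) /le_trans; apply.
rewrite le_eqVlt; apply/orP; left; apply/eqP; field.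
by rewrite gt_eqF.
Qed.

Let a0 := 3 * (mu^-1 + muc^-1 + kappa^-1).
Let b0 := mu * n%:R ^+ 2 * 2 ^+ 2 + muc * n%:R ^+ 2 + kappa * n%:R.

Let a0_ge0 : 0 <= a0.
Proof. by rewrite mulr_ge0 // !addr_ge0 // invr_ge0 ltW. Qed.

Let b0_ge0 : 0 <= b0.
Proof. by rewrite !addr_ge0 // !mulr_ge0 ?ltW // ?exprn_gt0 ?ltr0n. Qed.

Lemma iso_inner_bounds : exists c : R, [/\ 1 <= c,
  forall M, `|M| ^+ 2 <= c ^+ 2 * ip M M,
  forall M, ip M M <= c ^+ 2 * `|M| ^+ 2 &
  forall M K, ip (M *m K) (M *m K) <= c ^+ 2 * (ip M M * ip K K)].
Proof.
have n0 : 0 <= n%:R :> R by [].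
have le1 (x y : R) : 0 <= x -> 1 <= y -> x <= x * y by move=> *; nra.
have ip0 M : 0 <= ip M M.
  have [] := (mulr_ge0 (ltW mu0) (frob_ge0 (dev_part (sym_part M))),
    mulr_ge0 (ltW muc0) (frob_ge0 (skew_part M))) => h1 h2.
  have h3 := mulr_ge0 (divr_ge0 (ltW kappa0) n0) (sqr_ge0 (\tr M)).
  by rewrite /iso_inner -(expr2 (\tr M)); lra.
(* A product of factors at least 1 dominates each of them; its square also dominates
   [a0 ^ 2 * b0 * n ^ 2], the price of multiplying in the sup norm and returning to [ip]. *)
pose c := (1 + a0) * (1 + b0) * (1 + n%:R).
have c1 : 1 <= c by rewrite /c !mulr_ege1 // lerDl.
have cc : c <= c ^+ 2 by rewrite expr2 le1 // (le_trans _ c1).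
have ac : 1 + a0 <= c.
  have -> : c = (1 + a0) * ((1 + b0) * (1 + n%:R)) by rewrite /c; ring.
  by apply: le1; [exact: addr_ge0|rewrite mulr_ege1 // lerDl].
have bc : 1 + b0 <= c.
  have -> : c = (1 + b0) * ((1 + a0) * (1 + n%:R)) by rewrite /c; ring.
  by apply: le1; [exact: addr_ge0|rewrite mulr_ege1 // lerDl].
exists c; split => // [M|M|M K].
- apply: le_trans (norm_le_iso_inner M) _; apply: ler_wpM2r => //.
  by rewrite (le_trans _ cc) // (le_trans _ ac) // lerDr.
- apply: le_trans (iso_inner_le_norm M) _; apply: ler_wpM2r; rewrite ?sqr_ge0 //.
  by rewrite (le_trans _ cc) // (le_trans _ bc) // lerDr.
apply: le_trans (iso_inner_le_norm _) _; rewrite -/b0.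
have : `|M *m K| ^+ 2 <= n%:R ^+ 2 * (a0 * ip M M * (a0 * ip K K)).
  apply: (@le_trans _ _ ((n%:R * (`|M| * `|K|)) ^+ 2)).
    by rewrite ler_pXn2r ?nnegrE ?norm_mulmx_le // !mulr_ge0.
  rewrite !exprMn ler_wpM2l ?sqr_ge0 // ler_pM ?sqr_ge0 //; exact: norm_le_iso_inner.
move=> /(ler_wpM2l b0_ge0) /le_trans; apply.
have -> : b0 * (n%:R ^+ 2 * (a0 * ip M M * (a0 * ip K K))) =
  (a0 ^+ 2 * b0 * n%:R ^+ 2) * (ip M M * ip K K) by ring.
apply: ler_wpM2r; first by rewrite mulr_ge0.
have h x : 0 <= x -> x ^+ 2 <= (1 + x) ^+ 2 :> R by move=> x0; nra.
have -> : c ^+ 2 = (1 + a0) ^+ 2 * (1 + b0) ^+ 2 * (1 + n%:R) ^+ 2 by rewrite /c; ring.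
apply: (ler_pM (mulr_ge0 (sqr_ge0 _) b0_ge0) (sqr_ge0 _) _ (h _ n0)).
apply: (ler_pM (sqr_ge0 _) b0_ge0 (h _ a0_ge0)); nra.
Qed.

End iso_inner_norm.

Lemma iso_inner_norm_exists (R : realType) (n : nat) (mu muc kappa : R) :
  (1 <= n)%N -> 0 < mu -> 0 < muc -> 0 < kappa ->
  exists g : inner_norm R n, g = iso_inner mu muc kappa :> (_ -> _ -> _).
Proof.
move=> n1 mu0 muc0 kappa0.
have [c [c1 h1 h2 h3]] := iso_inner_bounds n1 mu0 muc0 kappa0.
by exists (InnerNorm (@iso_innerC _ _ mu muc kappa) (@iso_innerDl _ _ mu muc kappa)
  (@iso_innerZl _ _ mu muc kappa) c1 h1 h2 h3).
Qed.

(** * The norm of the inner product and the cost of one step *)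

Section norm_theory.
Variables (R : realType) (n : nat) (g : inner_norm R n).
Implicit Types x y z : 'M[R]_n.
Local Notation c := (icst g).

Definition nrm x : R := Num.sqrt (g x x).

Lemma icst_gt0 : 0 < c. Proof. exact: lt_le_trans ltr01 (icst_ge1 g). Qed.
Lemma icst_ge0 : 0 <= c. Proof. exact: ltW icst_gt0. Qed.
Local Hint Resolve icst_gt0 icst_ge0 : core.

Lemma innerDr x y z : g x (y + z) = g x y + g x z.
Proof. by rewrite innerC innerDl !(innerC _ _ x). Qed.

Lemma innerZr a x y : g x (a *: y) = a * g x y.
Proof. by rewrite innerC innerZl innerC. Qed.

Lemma innerNl x y : g (- x) y = - g x y.
Proof. by rewrite -scaleN1r innerZl mulN1r. Qed.

Lemma innerNr x y : g x (- y) = - g x y.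
Proof. by rewrite innerC innerNl innerC. Qed.

Lemma inner0l y : g 0 y = 0.
Proof. by rewrite -(scale0r (0 : 'M[R]_n)) innerZl mul0r. Qed.

Lemma inner_ge0 x : 0 <= g x x.
Proof.
rewrite -(@pmulr_rge0 _ (c ^+ 2)) ?exprn_gt0 //.
exact: le_trans (sqr_ge0 _) (norm_le_inner g x).
Qed.

Lemma nrm_ge0 x : 0 <= nrm x. Proof. exact: sqrtr_ge0. Qed.
Local Hint Resolve nrm_ge0 : core.

Lemma sqr_nrm x : nrm x ^+ 2 = g x x.
Proof. by rewrite sqr_sqrtr ?inner_ge0. Qed.

Lemma nrm_le a x : 0 <= a -> (nrm x <= a) = (g x x <= a ^+ 2).
Proof. by move=> a0; rewrite -sqr_nrm ler_pXn2r ?nnegrE. Qed.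

Lemma nrmZ a x : nrm (a *: x) = `|a| * nrm x.
Proof.
by rewrite /nrm innerZl innerZr mulrA -expr2 sqrtrM ?sqr_ge0 // sqrtr_sqr.
Qed.

Lemma nrmN x : nrm (- x) = nrm x.
Proof. by rewrite -scaleN1r nrmZ normrN1 mul1r. Qed.

Lemma nrm0 : nrm 0 = 0.
Proof. by rewrite /nrm inner0l sqrtr0. Qed.

Lemma norm_le_nrm x : `|x| <= c * nrm x.
Proof.
rewrite -(@ler_pXn2r _ 2) ?nnegrE ?mulr_ge0 // exprMn sqr_nrm.
exact: norm_le_inner.
Qed.

Lemma nrm_le_norm x : nrm x <= c * `|x|.
Proof. by rewrite nrm_le ?mulr_ge0 // exprMn inner_le_norm. Qed.

Lemma nrm_eq0 x : nrm x = 0 -> x = 0.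
Proof.
by move=> x0; apply/eqP; rewrite -normr_le0 (le_trans (norm_le_nrm x)) // x0 mulr0.
Qed.

Lemma nrm_mulmx x y : nrm (x *m y) <= c * (nrm x * nrm y).
Proof.
by rewrite nrm_le ?mulr_ge0 // !exprMn !sqr_nrm inner_mul_le.
Qed.

(** Cauchy-Schwarz, from the nonnegative square of [nrm y *: x - nrm x *: y] after division by
    [nrm x * nrm y]. *)
Lemma inner_le_nrm x y : g x y <= nrm x * nrm y.
Proof.
have [x0|x0] := eqVneq (nrm x) 0; first by rewrite (nrm_eq0 x0) inner0l nrm0 mul0r.
have [y0|y0] := eqVneq (nrm y) 0.
  by rewrite (nrm_eq0 y0) innerC inner0l nrm0 mulr0.
have := inner_ge0 (nrm y *: x - nrm x *: y).
rewrite innerDl !innerDr !innerNl !innerNr !innerZl !innerZr -!sqr_nrm (innerC _ y).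
have x1 : 0 < nrm x by rewrite lt_def x0 /=.
have y1 : 0 < nrm y by rewrite lt_def y0 /=.
move=> h; have xy : 0 < nrm x * nrm y by rewrite mulr_gt0.
rewrite -(ler_pM2l xy); lra.
Qed.

Lemma sqr_nrmD x y : nrm (x + y) ^+ 2 = nrm x ^+ 2 + 2 * g x y + nrm y ^+ 2.
Proof. rewrite !sqr_nrm innerDl !innerDr (innerC _ y x); ring. Qed.

Lemma nrmD x y : nrm (x + y) <= nrm x + nrm y.
Proof.
rewrite -(@ler_pXn2r _ 2) ?nnegrE ?addr_ge0 // sqr_nrmD sqrrD.
have := inner_le_nrm x y; lra.
Qed.

Lemma nrmB x y : nrm x - nrm y <= nrm (x + y).
Proof. by have := nrmD (x + y) (- y); rewrite addrK nrmN; lra. Qed.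

(** The size of the increment from [x] to [y] read in the frame of [x], hence unchanged when both
    are multiplied on the left. Symmetry and the triangle inequality hold only up to higher-order
    terms. *)
Definition step x y : R := nrm (invmx x *m y - 1%:M).

Lemma step_ge0 x y : 0 <= step x y. Proof. exact: nrm_ge0. Qed.

Lemma stepxx x : x \in unitmx -> step x x = 0.
Proof. by move=> ux; rewrite /step mulVmx // subrr nrm0. Qed.

Lemma step_eq0 x y : x \in unitmx -> step x y = 0 -> x = y.
Proof.
move=> ux /nrm_eq0/subr0_eq e.
by rewrite -[y](mulKVmx ux) e mulmx1.
Qed.

Lemma nrm_mul1D x y : nrm ((1%:M + x) *m y) <= (1 + c * nrm x) * nrm y.
Proof.
rewrite mulmxDl mul1mx (le_trans (nrmD _ _)) // mulrDl mul1r -mulrA lerD //.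
exact: nrm_mulmx.
Qed.

Lemma nrm_mul1D_ge x y : (1 - c * nrm x) * nrm y <= nrm ((1%:M + x) *m y).
Proof.
rewrite mulmxDl mul1mx (le_trans _ (nrmB _ _)) // mulrBl mul1r -mulrA lerB //.
exact: nrm_mulmx.
Qed.

Lemma mul_steps x y z : x \in unitmx -> y \in unitmx ->
  invmx x *m z = (invmx x *m y) *m (invmx y *m z).
Proof. by move=> ux uy; rewrite -!mulmxA mulKVmx. Qed.

(** With [S] and [T] the two increments, [x^-1 z = (1 + S) (1 + T)]. Thus [ln (1 + c * step)] obeys
    the triangle inequality. *)
Lemma step_trans x y z : x \in unitmx -> y \in unitmx ->
  1 + c * step x z <= (1 + c * step x y) * (1 + c * step y z).
Proof.
move=> ux uy; rewrite {1}/step (mul_steps z ux uy).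
set S := invmx x *m y - 1%:M; set T := invmx y *m z - 1%:M.
have -> : invmx x *m y *m (invmx y *m z) - 1%:M = (1%:M + S) *m T + S.
  rewrite /T mulmxBr mulmx1 /S [1%:M + _]addrC subrK; rewrite addrA subrK.
  by [].
have -> : step x y = nrm S by []. have -> : step y z = nrm T by [].
have := nrmD ((1%:M + S) *m T) S; have := nrm_mul1D S T.
have c0 := icst_gt0; have := nrm_ge0 S; have := nrm_ge0 T.
move=> h1 h2 h3 h4; have h5 := le_trans h4 (lerD h3 (lexx _)).
have := ler_wpM2l icst_ge0 h5; lra.
Qed.

(** In place of a Neumann series: a kernel matrix [M] of [1 + K] satisfies [M = - M K], so
    [nrm M <= c * nrm K * nrm M], which forces [M = 0]. *)
Lemma unitmx_near x y : x \in unitmx -> c * step x y < 1 -> y \in unitmx.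
Proof.
move=> ux h; set K := invmx x *m y - 1%:M in (h).
have eK : invmx x *m y = 1%:M + K by rewrite /K addrC subrK.
suff uK : invmx x *m y \in unitmx.
  by have := unitmx_mul x (invmx x *m y); rewrite mulKVmx // ux uK.
rewrite -row_free_unit -kermx_eq0; apply/eqP/nrm_eq0/eqP.
rewrite eq_le nrm_ge0 andbT leNgt; apply/negP => k0.
set M := kermx (invmx x *m y) in k0.
have : M *m (invmx x *m y) = 0 by apply/eqP; rewrite -sub_kermx.
rewrite eK mulmxDr mulmx1 => /eqP; rewrite addr_eq0 => /eqP e.
have : nrm M <= c * (nrm M * nrm K) by rewrite {1}e nrmN nrm_mulmx.
by rewrite leNgt mulrCA -{2}[nrm M]mulr1 ltr_pM2l // h.
Qed.

(** The reverse increment satisfies [Z = - (1 + Z) K], so [nrm Z <= (1 + c * nrm Z) * nrm K]; half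
    of [nrm Z] is absorbed on the left, whence the factor 2. *)
Lemma step_sym x y : x \in unitmx -> y \in unitmx -> c * step x y <= 1 / 2 ->
  step y x <= 2 * step x y.
Proof.
move=> ux uy h; rewrite /step.
set K := invmx x *m y - 1%:M; set Z := invmx y *m x - 1%:M.
have e : Z = - ((1%:M + Z) *m K).
  rewrite /K /Z [1%:M + _]addrC subrK mulmxBr mulmx1 mulmxA mulmxK //.
  by rewrite mulVmx // opprB.
have := nrm_mul1D Z K; rewrite -[nrm (_ *m K)]nrmN -e.
have := h; rewrite /step -/K => h' h1.
have : nrm Z * (c * nrm K) <= nrm Z * (1 / 2) by apply: ler_wpM2l.
lra.
Qed.

End norm_theory.

(** * Chains *)

Section chains.
Variables (R : realType) (n : nat) (g : inner_norm R n).
Implicit Types x y z : 'M[R]_n.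
Local Notation c := (icst g).
Local Notation step := (step g).

(* [chain e L x y]: a finite chain from [x] to [y] with steps of size at most [e]
   and of total cost [L]. *)
Inductive chain (e : R) : R -> 'M[R]_n -> 'M[R]_n -> Prop :=
| chain_nil x : x \in unitmx -> chain e 0 x x
| chain_cons x y z L : x \in unitmx -> step x y <= e -> chain e L y z ->
    chain e (step x y + L) x z.

Lemma chain_unitl e L x y : chain e L x y -> x \in unitmx.
Proof. by case. Qed.

Lemma chain_unitr e L x y : chain e L x y -> y \in unitmx.
Proof. by elim. Qed.

Lemma chain_ge0 e L x y : chain e L x y -> 0 <= L.
Proof. by elim=> // *; rewrite addr_ge0 // step_ge0. Qed.

Lemma chain_cat e L1 L2 x y z : chain e L1 x y -> chain e L2 y z ->
  chain e (L1 + L2) x z.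
Proof.
elim=> [? _|? ? ? ? ? ? _ IH /IH h]; first by rewrite add0r.
by rewrite -addrA; apply: chain_cons.
Qed.

Lemma chain_le e e' L x y : e <= e' -> chain e L x y -> chain e' L x y.
Proof.
move=> ee; elim=> [? ?|? ? ? ? ? h _ IH]; first exact: chain_nil.
by apply: chain_cons => //; apply: le_trans ee.
Qed.

Lemma chain1 e x y : x \in unitmx -> y \in unitmx -> step x y <= e ->
  chain e (step x y) x y.
Proof. by move=> ? ? ?; rewrite -[step x y]addr0; apply/chain_cons/chain_nil. Qed.

(** Each factor given by [step_trans] is at most the exponential of [c] times its step, so the bound
    depends on the total cost and not on the number of steps. *)
Lemma chain_growth e L x y : chain e L x y -> 1 + c * step x y <= expR (c * L).
Proof.
elim=> {x y L} [x ux|x y z L ux _ h IH].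
  by rewrite stepxx // !mulr0 addr0 expR0.
apply: le_trans (step_trans g z ux (chain_unitl h)) _.
rewrite [c * (_ + L)]mulrDr expRD; apply: ler_pM => //; last exact: expR_ge1Dx.
all: by rewrite addr_ge0 // mulr_ge0 ?step_ge0 ?icst_ge0.
Qed.

(** A fine chain runs backwards at no more than twice the cost. This is what bounds the inverses of
    its points. *)
Lemma chain_growth_rev e L x y : c * e <= 1 / 2 -> chain e L x y ->
  1 + c * step y x <= expR (2 * c * L).
Proof.
move=> ce; elim=> {x y L} [x ux|x y z L ux xye h IH].
  by rewrite stepxx // !mulr0 addr0 expR0.
have uy := chain_unitl h.
apply: le_trans (step_trans g x (chain_unitr h) uy) _.
rewrite [_ + L]addrC [_ * (L + _)]mulrDr expRD; apply: ler_pM => //.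
1,2: by rewrite addr_ge0 // mulr_ge0 ?step_ge0 ?icst_ge0.
apply: le_trans _ (expR_ge1Dx _); rewrite lerD2l [2 * c]mulrC -mulrA.
rewrite ler_wpM2l ?icst_ge0 //; apply: step_sym => //.
by apply: le_trans ce; rewrite ler_wpM2l ?icst_ge0.
Qed.

(** The same [e] bounds the mesh and the excess of cost, so reachable lengths add up and their
    infimum is again reachable. *)
Definition reach L x y :=
  forall e : R, 0 < e -> exists2 L' : R, L' <= L + e & chain e L' x y.

Lemma reach_trans L1 L2 x y z : reach L1 x y -> reach L2 y z -> reach (L1 + L2) x z.
Proof.
move=> h1 h2 e e0; have e2 : 0 < e / 2 by rewrite divr_gt0.
have [L1' l1 c1] := h1 _ e2; have [L2' l2 c2] := h2 _ e2.
exists (L1' + L2'); first by lra.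
apply: (@chain_le (e / 2)); first by rewrite ler_pdivrMr // ler_peMr ?ler1n // ltW.
exact: chain_cat c2.
Qed.

Lemma reach_growth L x y : reach L x y -> 1 + c * step x y <= expR (c * L).
Proof.
move=> h; have /ler_addgt0Pr hh : forall d, 0 < d -> ln (1 + c * step x y) <= c * L + d.
  move=> d d0; have e0 : 0 < d / c by rewrite divr_gt0 ?icst_gt0.
  have [L' l /chain_growth gr] := h _ e0.
  have p : 0 < 1 + c * step x y.
    by rewrite ltr_wpDr // mulr_ge0 ?step_ge0 ?icst_ge0.
  rewrite -ler_expR lnK ?posrE //; apply: (le_trans gr); rewrite ler_expR.
  apply: le_trans (ler_wpM2l (icst_ge0 g) l) _.
  by rewrite mulrDr lerD2l mulrC divfK ?gt_eqF ?icst_gt0.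
have p : 0 < 1 + c * step x y.
  by rewrite ltr_wpDr // mulr_ge0 ?step_ge0 ?icst_ge0.
by rewrite -[leLHS]lnK ?posrE // ler_expR.
Qed.

End chains.

(** At the supremum of the [t] with [P a t], the local hypothesis reaches the supremum from the left
    and passes beyond it unless it is [b]. Intervals are tested with the tag [t] at one end and a
    radius depending on [t], the form in which a derivative at [t] gives information. *)
Lemma cousin (R : realType) (P : R -> R -> Prop) (a b : R) : a <= b ->
  (forall s t u, a <= s -> s <= t -> t <= u -> u <= b -> P s t -> P t u -> P s u) ->
  (forall t, a <= t <= b -> exists2 d : R, 0 < d &
    forall s, a <= s <= b -> `|s - t| < d -> (s <= t -> P s t) /\ (t <= s -> P t s)) ->
  P a b.
Proof.
move=> ab Padd Ploc.
pose S := [set t | a <= t <= b /\ P a t].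
have Sa : S a.
  split; first by rewrite lexx.
  have [|d d0 h] := Ploc a; first by rewrite lexx.
  by have [||h1 _] := h a; rewrite ?lexx ?subrr ?normr0 ?ab ?d0 //; apply: h1.
have hS : has_sup S by split; [exists a|exists b => t [/andP[]]].
have am : a <= sup S by apply: ub_le_sup => //; case: hS.
have mb : sup S <= b by apply: ge_sup => [|t [/andP[]]]; first by exists a.
have [|d d0 h] := Ploc (sup S); first by rewrite am.
have [t [/andP[at_ tb] Pt] tm] := sup_adherent d0 hS.
have tS : t <= sup S by apply: ub_le_sup; [case: hS|split => //; rewrite at_].
have Pm : P a (sup S).
  apply: (Padd a t) => //; have [||h1 _] := h t; rewrite ?at_ //; last exact: h1.
  by rewrite ler0_norm ?subr_le0 // opprB ltrBlDr addrC -ltrBlDr.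
(* Half of [d] keeps [u] strictly inside the radius; [u <= sup S] is then possible only if the
   minimum is [b]. *)
pose u := Num.min b (sup S + d / 2).
have d2 : 0 < d / 2 by rewrite divr_gt0.
have mu_ : sup S <= u by rewrite le_min mb lerDl ltW.
have ub_ : u <= b by rewrite ge_min lexx.
have Pu : P a u.
  apply: (Padd a (sup S)) => //; have [||_ h1] := h u; rewrite ?ub_ ?andbT.
  - exact: le_trans mu_.
  - rewrite ger0_norm ?subr_ge0 // ltrBlDr gt_min; apply/orP; right.
    by lra.
  - exact: h1.
have uS : u <= sup S.
  by apply: ub_le_sup; [case: hS|split => //; rewrite ub_ (le_trans am)].
have -> // : b = u.
move: uS; rewrite /u; case: (leP b) => // _; lra.
Qed.

(** * Chains along curves and straight segments *)

Section curves.
Variables (R : realType) (n : nat) (g : inner_norm R n).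
Implicit Types x y z : 'M[R]_n.
Local Notation c := (icst g).
Local Notation step := (step g).
Local Notation nrm := (nrm g).
Local Notation chain := (chain g).
Local Notation reach := (reach g).

(** The weight [mu] of intervals is superadditive, so local comparisons of steps with [mu] sum up by
    Cousin's lemma. It will be a multiple of the interval length or of the integral of the speed. *)
Lemma chain_curve (X : R -> 'M[R]_n) (a b e : R) (mu : R -> R -> R) : a <= b ->
  (forall t, a <= t <= b -> X t \in unitmx) ->
  (forall s t u, a <= s -> s <= t -> t <= u -> u <= b -> mu s t + mu t u <= mu s u) ->
  (forall t, a <= t <= b -> exists2 d : R, 0 < d &
    forall s, a <= s <= b -> `|s - t| < d ->
    (s <= t -> step (X s) (X t) <= Num.min e (mu s t)) /\
    (t <= s -> step (X t) (X s) <= Num.min e (mu t s))) ->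
  exists2 L : R, L <= mu a b & chain e L (X a) (X b).
Proof.
move=> ab uX addmu loc.
apply: (@cousin _ (fun s t => exists2 L : R, L <= mu s t & chain e L (X s) (X t))) => //.
  move=> s t u as_ st tu ub_ [L1 l1 c1] [L2 l2 c2].
  by exists (L1 + L2); [apply: le_trans (addmu _ t _ _ _ _ _) => //; apply: lerD|apply: chain_cat c2].
move=> t tab; have [d d0 h] := loc t tab; exists d => // s sab sd.
have [h1 h2] := h s sab sd; split => [/h1|/h2]; rewrite le_min => /andP[he hm].
  by exists (step (X s) (X t)) => //; apply: chain1; rewrite ?uX.
by exists (step (X t) (X s)) => //; apply: chain1; rewrite ?uX.
Qed.

Lemma chain_lipschitz (X : R -> 'M[R]_n) (a b K d e : R) : a <= b -> 0 < d -> 0 <= K -> 0 < e ->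
  (forall t, a <= t <= b -> X t \in unitmx) ->
  (forall s t, a <= s -> s <= t -> t <= b -> t - s < d ->
    step (X s) (X t) <= K * (t - s)) ->
  exists2 L : R, L <= K * (b - a) & chain e L (X a) (X b).
Proof.
move=> ab d0 K0 e0 uX lip.
apply: (@chain_curve _ _ _ _ (fun s t => K * (t - s))) => //.
  by move=> s t u *; rewrite -mulrDr addrC addrA subrK.
(* Within this radius [K * (t - s) <= e]; [K + 1] avoids a division by zero. *)
move=> t /andP[at_ tb]; exists (Num.min d (e / (K + 1))).
  by rewrite lt_min d0 divr_gt0 // ltr_wpDl.
have Ke (u : R) : 0 <= u -> u < e / (K + 1) -> K * u <= e.
  by move=> u0; rewrite ltr_pdivlMr ?ltr_wpDl // => h; lra.
move=> s /andP[as_ sb]; rewrite lt_min => /andP[sd se]; split => st; rewrite le_min.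
  have := lip s t as_ st tb; rewrite distrC ger0_norm ?subr_ge0 // in sd se *.
  move=> /(_ sd) h; rewrite h andbT (le_trans h) // Ke // subr_ge0 //.
have := lip t s at_ st sb; rewrite ger0_norm ?subr_ge0 // in sd se *.
move=> /(_ sd) h; rewrite h andbT (le_trans h) // Ke // subr_ge0 //.
Qed.

Lemma nrm_solve (K y z : 'M[R]_n) : (1%:M + K) *m y = z -> c * nrm K < 1 ->
  nrm y <= nrm z / (1 - c * nrm K).
Proof.
move=> <- h; rewrite ler_pdivlMr ?subr_gt0 // mulrC.
exact: nrm_mul1D_ge.
Qed.

(** The segment [x (1 + s H)], with [H] the increment, has left-translated velocity
    [(1 + s H)^-1 H], of norm at most [r / (1 - c r)] where [r] is the step. *)
Lemma segment_reach x y : x \in unitmx -> c * step x y <= 1 / 2 ->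
  y \in unitmx /\ reach (step x y / (1 - c * step x y)) x y.
Proof.
move=> ux; set r := step x y => h.
have r0 : 0 <= r by exact: step_ge0.
have h1 : c * r < 1 by lra.
split; first exact: unitmx_near h1.
move=> e e0; pose H := invmx x *m y - 1%:M.
pose X (s : R) := x *m (1%:M + s *: H).
have X0 : X 0 = x by rewrite /X scale0r addr0 mulmx1.
have X1 : X 1 = y by rewrite /X scale1r /H addrC subrK mulKVmx.
have sr (s : R) : 0 <= s <= 1 -> step x (X s) <= r.
  move=> /andP[s0 s1]; rewrite /step /X mulKmx // addrC addKr nrmZ ger0_norm //.
  by rewrite ler_piMl.
have uX (s : R) : 0 <= s <= 1 -> X s \in unitmx.
  move=> hs; apply: (unitmx_near (g := g) ux); apply: le_lt_trans h1.
  by rewrite ler_wpM2l ?icst_ge0 ?sr.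
have [||||||L hL cL] := @chain_lipschitz X 0 1 (r / (1 - c * r)) 1 e => //.
- by rewrite divr_ge0 // subr_ge0 ltW.
- move=> s t s0 st t1 _; have hs : 0 <= s <= 1 by rewrite s0 (le_trans st).
  rewrite /step.
  have -> : invmx (X s) *m X t - 1%:M = (t - s) *: (invmx (1%:M + s *: H) *m H).
    have uI : 1%:M + s *: H \in unitmx by have := uX s hs; rewrite unitmx_mul ux.
    have -> : X t = X s + (t - s) *: (x *m H).
      have XE u : X u = x + u *: (x *m H) by rewrite /X mulmxDr mulmx1 scalemxAr.
      by rewrite !XE -addrA -scalerDl [s + _]addrC subrK.
    rewrite mulmxDr mulVmx ?uX // addrC addKr -scalemxAr /X.
    have -> : invmx (x *m (1%:M + s *: H)) = invmx (1%:M + s *: H) *m invmx x.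
      apply: (can_inj (mulKmx (uX s hs))).
      by rewrite mulmxV ?uX // mulmxA mulmxK // mulmxV.
    by rewrite -mulmxA mulKmx.
  rewrite nrmZ mulrC ger0_norm ?subr_ge0 // ler_wpM2r ?subr_ge0 //.
  have uI : 1%:M + s *: H \in unitmx by have := uX s hs; rewrite unitmx_mul ux.
  have e1 := mulKVmx uI H.
  have le_sH : c * nrm (s *: H) <= c * r.
    by rewrite ler_wpM2l ?icst_ge0 // nrmZ ger0_norm // ler_piMl //; case/andP: hs.
  apply: (le_trans (nrm_solve e1 _)); first exact: le_lt_trans h1.
  have -> : nrm H = r by [].
  rewrite ler_wpM2l // lef_pV2 ?posrE ?subr_gt0 //; last exact: le_lt_trans h1.
  by rewrite lerB.
rewrite X0 X1 in cL; exists L => //; apply: (le_trans hL).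
by rewrite subr0 mulr1 lerDl ltW.
Qed.

End curves.

(** * Limits of almost optimal chains *)

Section matrix_limits.
Variables (R : realType) (n : nat).

Lemma cvg_mxP T (F : set_system T) {FF : Filter F} (f : T -> 'M[R]_n) (a : 'M[R]_n) :
  f @ F --> a <-> forall i j, f x i j @[x --> F] --> a i j.
Proof.
split=> [fa i j|h].
  exact: (cvg_comp _ _ fa (@coord_continuous _ _ _ i j a)).
apply/cvgrPdist_le => e e0.
have : \forall x \near F, forall ij : 'I_n * 'I_n, `|a ij.1 ij.2 - f x ij.1 ij.2| <= e.
  apply: filter_forall => -[i j]; have /cvgrPdist_le := h i j; exact.
apply: filterS => x hx; apply: norm_le_entries; first exact: ltW.
by move=> i j; have := hx (i, j); rewrite !mxE.
Qed.

Lemma mx_cvg_cst T (F : set_system T) {FF : ProperFilter F} (a b : 'M[R]_n) :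
  a @[_ --> F] --> b -> a = b.
Proof.
move=> h.
have h0 : a @[_ --> F] --> a by exact: cvg_cst.
exact: (@norm_cvg_unique R _ (a @[_ --> F]) (fmap_proper_filter _ FF) a b h0 h).
Qed.

Lemma cvg_mulmx T (F : set_system T) {FF : Filter F} (f h : T -> 'M[R]_n) (a b : 'M[R]_n) :
  f @ F --> a -> h @ F --> b -> f x *m h x @[x --> F] --> a *m b.
Proof.
move=> /cvg_mxP fa /cvg_mxP hb; apply/cvg_mxP => i j; rewrite mxE.
under eq_fun do rewrite mxE.
apply: cvg_big => [|k _]; first exact: add_continuous.
by apply: cvgM; [exact: fa|exact: hb].
Qed.

(** A cluster point of an ultrafilter is a limit. One ultrafilter thus serves all parameters of a
    curve at once, where extracting subsequences would handle only countably many. *)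
Lemma ultra_cvg_bounded T (U : set_system T) {UU : UltraFilter U} (x : T -> R) (C : R) :
  (forall k, `|x k| <= C) -> exists y : R, x @ U --> y.
Proof.
move=> xC; have [|y [_ cl]] := @segment_compact R (- C) C (x @ U) _.
  suff : U (x @^-1` `[- C, C]) by [].
  by apply: filterE => k; rewrite /= in_itv /= -ler_norml; exact: xC.
exists y => V Vy; have [//|UV] := in_ultra_setVsetC (x @^-1` V) UU.
have [z [/= zV Vz]] := cl (~` V) V UV Vy.
by case: (zV Vz).
Qed.

Lemma ultra_cvg_mx T (U : set_system T) {UU : UltraFilter U} (x : T -> 'M[R]_n) (C : R) :
  (forall k, `|x k| <= C) -> exists y : 'M[R]_n, x @ U --> y.
Proof.
move=> xC; have /choice[y yP] (ij : 'I_n * 'I_n) : exists y : R, x k ij.1 ij.2 @[k --> U] --> y.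
  apply: (@ultra_cvg_bounded _ _ _ _ C) => k; apply: le_trans (xC k).
  exact: entry_le_norm.
exists (\matrix_(i, j) y (i, j)); apply/cvg_mxP => i j; rewrite mxE; exact: (yP (i, j)).
Qed.

Lemma cvg_nrm (g : inner_norm R n) T (F : set_system T) {FF : Filter F}
    (f : T -> 'M[R]_n) (a : 'M[R]_n) : f @ F --> a -> nrm g (f x) @[x --> F] --> nrm g a.
Proof.
move=> /cvgrPdist_le fa; apply/cvgrPdist_le => e e0.
have c0 := icst_gt0 g.
have := fa _ (divr_gt0 e0 c0); apply: filterS => x hx.
have h : nrm g (a - f x) <= e.
  apply: (le_trans (nrm_le_norm g _)); apply: le_trans (ler_wpM2l (ltW c0) hx) _.
  by rewrite mulrC divfK ?gt_eqF.
rewrite ler_norml; apply/andP; split.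
  have := nrmD g (f x - a) a; rewrite subrK -[nrm g (f x - a)]nrmN opprB; lra.
by have := nrmD g (a - f x) (f x); rewrite subrK; lra.
Qed.

End matrix_limits.

Section sampling.
Variables (R : realType) (n : nat) (g : inner_norm R n).
Implicit Types x y z A B : 'M[R]_n.
Local Notation c := (icst g).
Local Notation step := (step g).
Local Notation nrm := (nrm g).
Local Notation chain := (chain g).
Local Notation reach := (reach g).

(* [X s] is the last point of the chain reached at cost at most [s]. *)
Lemma chain_sample (e L : R) x y : 0 <= e -> chain e L x y ->
  exists X : R -> 'M[R]_n,
  [/\ forall s, 0 <= s -> exists2 L' : R, L' <= s & chain e L' x (X s),
      forall s t, 0 <= s -> s <= t -> exists2 L' : R, L' <= t - s + e & chain e L' (X s) (X t) &
      forall s, L <= s -> X s = y].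
Proof.
move=> e0; elim=> {x y L} [x ux|x y z L ux xy yz [X [X1 X2 X3]]].
  exists (fun=> x); split=> // [s s0|s t _ st]; first by exists 0 => //; exact: chain_nil.
  by exists 0; [rewrite addr_ge0 // subr_ge0|exact: chain_nil].
set r := step x y in xy *.
have r0 : 0 <= r by exact: step_ge0.
pose Z s := if s < r then x else X (s - r).
have Z1 s : 0 <= s -> exists2 L' : R, L' <= s & chain e L' x (Z s).
  move=> s0; rewrite /Z; case: ltP => sr; first by exists 0 => //; exact: chain_nil.
  have [|L' hL cL] := X1 (s - r); first by rewrite subr_ge0.
  by exists (r + L'); [rewrite -lerBrDl|exact: chain_cons].
exists Z; split => // [s t s0 st|s rLs].
  (* Before [r] the sample still waits at [x]; a chain to [Z t] of cost at most [t] then costs at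
     most [t - s + e], because [s < r <= e]. *)
  have [sr|sr] := ltP s r.
    have [L' hL cL] := Z1 t (le_trans s0 st).
    exists L'; last by rewrite {1}/Z sr.
    by apply: (le_trans hL); have := ltW (lt_le_trans sr xy); lra.
  have [||L' hL cL] := X2 (s - r) (t - r); rewrite ?subr_ge0 ?lerB //.
  rewrite /Z !ltNge sr (le_trans sr st) /=; exists L' => //.
  by apply: (le_trans hL); lra.
have L0 := chain_ge0 yz.
by rewrite /Z ltNge (le_trans _ rLs) ?lerDl //= X3 // lerBrDl.
Qed.

(** Through [chain_growth] the bound [t - s + e k] on the cost between two samples becomes a closed
    inequality, from which [e k] disappears in the limit. *)
Lemma reach_curve (l : R) A B : 0 <= l -> reach l A B ->
  exists X : R -> 'M[R]_n, [/\ X 0 = A, X l = B,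
    forall s, 0 <= s <= l -> X s \in unitmx &
    forall s t, 0 <= s -> s <= t -> t <= l ->
      1 + c * step (X s) (X t) <= expR (c * (t - s))].
Proof.
move=> l0 rl; have c0 := icst_gt0 g; have c0' := ltW c0.
(* The bound [1 / (2 c)] makes the chains fine enough for [chain_growth_rev]. *)
pose e (k : nat) : R := Num.min k.+1%:R^-1 (1 / 2 / c).
have e0 k : 0 < e k by rewrite lt_min invr_gt0 ltr0Sn !divr_gt0.
have ec k : c * e k <= 1 / 2.
  by rewrite mulrC -ler_pdivlMr // ge_min lexx orbT.
have el k : e k <= k.+1%:R^-1 by rewrite ge_min lexx.
have /choice[L /choice[X XP]] k : exists L, exists X : R -> 'M[R]_n, [/\ L <= l + e k,
    forall s, 0 <= s -> exists2 L' : R, L' <= s & chain (e k) L' A (X s),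
    forall s t, 0 <= s -> s <= t -> exists2 L' : R, L' <= t - s + e k & chain (e k) L' (X s) (X t) &
    forall s, L <= s -> X s = B].
  have [L hL cL] := rl _ (e0 k).
  have [X [X1 X2 X3]] := chain_sample (ltW (e0 k)) cL.
  by exists L, X.
have X1 k : forall s, 0 <= s -> exists2 L' : R, L' <= s & chain (e k) L' A (X k s).
  by case: (XP k).
have X2 k s t : 0 <= s -> s <= t ->
    exists2 L' : R, L' <= t - s + e k & chain (e k) L' (X k s) (X k t).
  by case: (XP k) => _ _ + _; apply.
have uA : A \in unitmx by have [L' _ /chain_unitl] := X1 0 0 (lexx _).
have uX k s : 0 <= s -> X k s \in unitmx.
  by move=> /(X1 k)[L' _ /chain_unitr].
have [U [UU UN]] := @ultraFilterLemma nat \oo _.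
have UF : ProperFilter U by case: UU.
have FU : Filter U by exact: filter_filter.
pose C := expR (2 * c * l) / c.
have sub_le (r E : R) : 1 + c * r <= E -> r <= E / c.
  by move=> h; rewrite ler_pdivlMr // mulrC; lra.
have sX k s : 0 <= s <= l -> step A (X k s) <= C /\ step (X k s) A <= C.
  move=> /andP[s0 sl]; have [L' hL cL] := X1 k s s0.
  have L0 := chain_ge0 cL; have Ll := le_trans hL sl.
  split; apply: sub_le.
    apply: (le_trans (chain_growth cL)); rewrite ler_expR; apply: ler_pM => //.
    by rewrite ler_peMl // ler1n.
  apply: (le_trans (chain_growth_rev (ec k) cL)); rewrite ler_expR ler_wpM2l //.
  by rewrite mulr_ge0.
have bd (Q : 'M[R]_n) : nrm (Q - 1%:M) <= C ->
    nrm Q <= C + nrm 1%:M.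
  move=> h; have := nrmD g (Q - 1%:M) 1%:M; rewrite subrK; lra.
have bX k s : 0 <= s <= l ->
    `|X k s| <= c * (c * (nrm A * (C + nrm 1%:M))) /\
    `|invmx (X k s)| <= c * (c * ((C + nrm 1%:M) * nrm (invmx A))).
  move=> hs; have [h1 h2] := sX k s hs; have s0 : 0 <= s by case/andP: hs.
  split; apply: (le_trans (norm_le_nrm g _)); apply: ler_wpM2l => //.
    rewrite -[X k s](mulKVmx uA); apply: (le_trans (nrm_mulmx g _ _)).
    by apply: ler_wpM2l => //; apply: ler_wpM2l; [exact: nrm_ge0|exact: bd].
  rewrite -[invmx (X k s)](mulmxK uA); apply: (le_trans (nrm_mulmx g _ _)).
  by apply: ler_wpM2l => //; apply: ler_wpM2r; [exact: nrm_ge0|exact: bd].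
(* The inverses converge along the same ultrafilter; their limit [W s] is a left inverse of [Y s],
   so the limit curve stays invertible. *)
have /choice[Y /choice[W YW]] (s : R) : exists Y : 'M[R]_n, exists W : 'M[R]_n, 0 <= s <= l ->
    X k s @[k --> U] --> Y /\ invmx (X k s) @[k --> U] --> W.
  have [hs|hs] := boolP (0 <= s <= l); last by exists 0, 0.
  have [Y hY] := ultra_cvg_mx (fun k => (bX k s hs).1).
  have [W hW] := ultra_cvg_mx (fun k => (bX k s hs).2).
  by exists Y, W.
have WY s : 0 <= s <= l -> W s *m Y s = 1%:M.
  move=> hs; have [h1 h2] := YW s hs; have := @cvg_mulmx _ _ _ U FU _ _ _ _ h2 h1.
  have s0 : 0 <= s by case/andP: hs.
  under eq_fun do rewrite mulVmx ?uX //.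
  by move=> h; rewrite -(@mx_cvg_cst _ _ _ U _ _ _ h).
have uY s : 0 <= s <= l -> Y s \in unitmx.
  by move=> /WY /mulmx1_unit[].
have WE s : 0 <= s <= l -> W s = invmx (Y s).
  move=> hs; by rewrite -[W s](mulmxK (uY s hs)) WY // mul1mx.
have ke : e k @[k --> U] --> (0 : R).
  apply: (@squeeze_cvgr _ _ _ _ (fun=> 0) (fun k => k.+1%:R^-1)).
  - by apply: filterE => k; rewrite el ltW.
  - exact: cvg_cst.
  - apply: cvg_trans (@cvg_harmonic R); exact: cvg_app.
(* [m] counts the errors [e k]: none at the start, one for the lag between two samples, and a second
   one at [B], because chain [k] may cost up to [l + e k]. *)
have lim (Z : nat -> 'M[R]_n) (z : 'M[R]_n) s (d m : R) : 0 <= s <= l ->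
    Z k @[k --> U] --> z ->
    (forall k, 1 + c * step (X k s) (Z k) <= expR (c * (d + m * e k))) ->
    1 + c * step (Y s) z <= expR (c * d).
  move=> hs hZ h.
  have l1 : 1 + c * step (X k s) (Z k) @[k --> U] --> 1 + c * step (Y s) z.
    apply: cvgD; first exact: cvg_cst.
    apply: cvgM; first exact: cvg_cst.
    apply: cvg_nrm; rewrite -WE //; apply: cvgB; last exact: cvg_cst.
    by apply: cvg_mulmx => //; case: (YW s hs).
  have l2 : expR (c * (d + m * e k)) @[k --> U] --> expR (c * d).
    rewrite -[X in _ --> expR (c * X)]addr0 -[X in _ --> expR (c * (d + X))](mulr0 m).
    apply: continuous_cvg; first exact: continuous_expR.
    apply: cvgM; first exact: cvg_cst.
    apply: cvgD; first exact: cvg_cst.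
    by apply: cvgM => //; exact: cvg_cst.
  by apply: (ler_cvg_to l1 l2); apply: filterE.
have h0 : (0 : R) <= 0 <= l by apply/andP.
have hl : 0 <= l <= l by rewrite lexx l0.
have eq_of u v : u \in unitmx -> 1 + c * step u v <= expR (c * 0) -> u = v.
  move=> uu; rewrite mulr0 expR0 => h; apply: (step_eq0 (g := g) uu).
  have s0 := step_ge0 g u v; apply/eqP; rewrite eq_le s0 andbT.
  by rewrite -(pmulr_rle0 _ c0); lra.
exists Y; split => //.
- apply: (eq_of); first exact: uY.
  apply: (lim (fun=> A) _ _ _ 0) => //; first exact: cvg_cst.
  move=> k; have [L' hL cL] := X1 k 0 (lexx _).
  have -> : X k 0 = A.
    apply/esym; apply: (eq_of) => //; apply: (le_trans (chain_growth cL)).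
    by rewrite ler_expR ler_wpM2l.
  by rewrite stepxx // mul0r addr0 !mulr0 addr0 expR0.
- apply: (eq_of); first exact: uY.
  apply: (lim (fun=> B) _ _ _ 2) => //; first exact: cvg_cst.
  move=> k; have [Lk _ _ XB] := XP k.
  (* Chain [k] may end only beyond cost [l]; the sample is followed up to [Num.max (L k) l], where
     it has certainly reached [B]. *)
  have lt : l <= Num.max (L k) l by rewrite le_max lexx orbT.
  have [L' hL cL] := X2 k l _ l0 lt; rewrite (XB (Num.max (L k) l)) ?le_max ?lexx // in cL.
  apply: (le_trans (chain_growth cL)); rewrite ler_expR ler_wpM2l //.
  apply: (le_trans hL); rewrite add0r mulr_natl mulr2n lerD2r lerBlDl.
  by rewrite ge_max Lk lerDl ltW.
- move=> s t s0 st tl; have hs : 0 <= s <= l by rewrite s0 (le_trans st).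
  have ht : 0 <= t <= l by rewrite tl (le_trans s0).
  apply: (lim (fun k => X k t) _ _ _ 1) => //; first by case: (YW t ht).
  move=> k; have [L' hL cL] := X2 k s t s0 st.
  by apply: (le_trans (chain_growth cL)); rewrite ler_expR ler_wpM2l // mul1r.
Qed.

End sampling.

(** * Regularity of minimal curves *)

Lemma expR_le_inv (R : realType) (x : R) : x < 1 -> expR x <= (1 - x)^-1.
Proof.
move=> x1; rewrite -[expR x]invrK lef_pV2 ?posrE ?invr_gt0 ?expR_gt0 ?subr_gt0 //.
by rewrite -expRN; exact: expR_ge1Dx.
Qed.

Section minimal_curve.
Variables (R : realType) (n : nat) (g : inner_norm R n).
Implicit Types A B M : 'M[R]_n.
Local Notation c := (icst g).
Local Notation step := (step g).
Local Notation nrm := (nrm g).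
Local Notation reach := (reach g).

Lemma reach_ge0 (L : R) A B : reach L A B -> 0 <= L.
Proof.
move=> h; apply/ler_addgt0Pr => e e0; have [L' hL /chain_ge0 L0] := h e e0.
exact: le_trans hL.
Qed.

Lemma reach_min (L0 : R) A B : reach L0 A B ->
  exists2 l : R, reach l A B & forall L : R, reach L A B -> l <= L.
Proof.
move=> h0; pose S := [set L : R | reach L A B].
have hS : has_inf S by split; [exists L0|exists 0 => L /reach_ge0].
exists (inf S); last by move=> L hL; apply: ge_inf => //; case: hS.
move=> e e0; have e2 : 0 < e / 2 by rewrite divr_gt0.
have [L SL Ll] := inf_adherent e2 hS.
have [L' hL' cL'] := SL _ e2; exists L'; first by lra.
by apply: chain_le cL'; lra.
Qed.

(** The second clause bounds steps from above; the third, minimality of [l], will bound them from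
    below. *)
Definition minimal_curve (l : R) (X : R -> 'M[R]_n) :=
  [/\ forall s, 0 <= s <= l -> X s \in unitmx,
      forall s t, 0 <= s -> s <= t -> t <= l ->
        1 + c * step (X s) (X t) <= expR (c * (t - s)) &
      forall L, reach L (X 0) (X l) -> l <= L].

Section estimates.
Variables (l : R) (X : R -> 'M[R]_n).
Hypothesis mX : minimal_curve l X.

Let c0 : 0 < c := icst_gt0 g.
Let c0' : 0 <= c := icst_ge0 g.

Lemma minimal_unit s : 0 <= s -> s <= l -> X s \in unitmx.
Proof. by move=> s0 sl; case: mX => + _ _; apply; rewrite s0. Qed.

Lemma minimal_step_le s t : 0 <= s -> s <= t -> t <= l -> c * (t - s) < 1 ->
  step (X s) (X t) <= (t - s) / (1 - c * (t - s)).
Proof.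
move=> s0 st tl h; case: mX => _ /(_ s t s0 st tl) gr _.
have d0 : 0 < 1 - c * (t - s) by rewrite subr_gt0.
have hh : (1 + c * step (X s) (X t)) * (1 - c * (t - s)) <= 1.
  by rewrite -ler_pdivlMr // mul1r; exact: le_trans gr (expR_le_inv h).
by rewrite ler_pdivlMr // -(ler_pM2l c0); lra.
Qed.

(** On short intervals the growth bound makes [X] Lipschitz for [step] with a constant as close to 1
    as desired. *)
Lemma minimal_reach s t : 0 <= s -> s <= t -> t <= l -> reach (t - s) (X s) (X t).
Proof.
move=> s0 st tl e e0.
have p1 : 0 < 1 + (t - s) by rewrite ltr_pwDl // subr_ge0.
pose k := e / (1 + (t - s)).
have k0 : 0 < k by rewrite divr_gt0.
(* As [c * d = k / (1 + k)], the factor [1 / (1 - c * (v - u))] is at most [1 + k] on intervals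
   shorter than [d]; the choice of [k] gives [k * (t - s) <= e]. *)
pose d := k / (1 + k) / c.
have k1 : 0 < 1 + k by rewrite addr_gt0.
have d0 : 0 < d by rewrite !divr_gt0.
have [||||||L hL cL] := @chain_lipschitz _ _ g X s t (1 + k) d e => //.
- exact: ltW.
- by move=> u /andP[us ut]; apply: minimal_unit; [exact: le_trans us|exact: le_trans tl].
- move=> u v su uv vt uvd.
  have h : c * (v - u) < k / (1 + k).
    by move: uvd; rewrite /d ltr_pdivlMr // mulrC.
  have h1 : k / (1 + k) < 1 by rewrite ltr_pdivrMr // mul1r ltrDr.
  apply: (le_trans (minimal_step_le _ _ _ _)) => //.
  + exact: le_trans su.
  + exact: le_trans tl.
  + exact: lt_trans h1.
  rewrite mulrC ler_wpM2r ?subr_ge0 // -[(_ - _)^-1]div1r ler_pdivrMr ?subr_gt0; last first.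
    exact: lt_trans h1.
  by move: h; rewrite ltr_pdivlMr //; lra.
exists L => //; apply: (le_trans hL); rewrite mulrDl mul1r lerD2l /k.
by rewrite mulrAC ler_pdivrMr // ler_wpM2l ?ltW // ltrDr.
Qed.

(** Replacing the piece from [X s] to [X t] by a straight segment shows that
    [s + r / (1 - c r) + (l - t)] is reachable, with [r] the step; minimality makes it at least
    [l]. *)
Lemma minimal_step_ge s t : 0 <= s -> s <= t -> t <= l ->
  c * step (X s) (X t) <= 1 / 2 ->
  t - s <= step (X s) (X t) / (1 - c * step (X s) (X t)).
Proof.
move=> s0 st tl h.
have [_ hr] := segment_reach (minimal_unit s0 (le_trans st tl)) h.
have r1 := minimal_reach (lexx 0) s0 (le_trans st tl).
have r2 := minimal_reach (le_trans s0 st) tl (lexx l).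
case: mX => _ _ /(_ _ (reach_trans (reach_trans r1 hr) r2)); lra.
Qed.

Lemma minimal_step s t : 0 <= s -> s <= t -> t <= l -> c * (t - s) <= 1 / 4 ->
  (1 - 2 * c * (t - s)) * (t - s) <= step (X s) (X t) <= (1 + 2 * c * (t - s)) * (t - s).
Proof.
move=> s0 st tl h; have := @minimal_step_le s t s0 st tl.
have := @minimal_step_ge s t s0 st tl.
set r := step _ _; set d := t - s in h *.
have r0 : 0 <= r by exact: step_ge0.
have d0 : 0 <= d by rewrite subr_ge0.
have cd0 : 0 <= c * d by rewrite mulr_ge0.
move=> h1 h2.
have hd : 0 < 1 - c * d by lra.
have : r <= d / (1 - c * d) by apply: h2; lra.
rewrite ler_pdivlMr // => hr.
have r2 : r <= 2 * d by nra.
have cr : c * r <= 1 / 2.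
  by apply: (le_trans (ler_wpM2l c0' r2)); lra.
have hr' : 0 < 1 - c * r by lra.
have := h1 cr; rewrite ler_pdivlMr // => hh.
have h3 : (c * d) * r <= (c * d) * (2 * d) by apply: ler_wpM2l.
apply/andP; split; first by lra.
rewrite -(ler_pM2r hd); apply: (le_trans hr).
have : 0 <= d * (c * d) * (1 - 2 * (c * d)).
  by rewrite mulr_ge0 ?mulr_ge0 //; lra.
lra.
Qed.

(** Chords add up only when read in one frame, here that of [X p]. Passing to it from the frame of
    [X s] multiplies by [1 + K] with [c * nrm K <= 2 x], where [x = c * (t - p)]; the 5 absorbs
    [(1 + 2 x) ^ 2 <= 1 + 5 x]. *)
Lemma minimal_chord p s t : 0 <= p -> p <= s -> s <= t -> t <= l -> 5 * c * (t - p) <= 1 ->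
  (1 - 5 * c * (t - p)) * (t - s) <= nrm (invmx (X p) *m (X t - X s)) <=
  (1 + 5 * c * (t - p)) * (t - s).
Proof.
move=> p0 ps st tl h; have s0 := le_trans p0 ps; have sl := le_trans st tl.
have up := minimal_unit p0 (le_trans ps sl); have us := minimal_unit s0 sl.
have ce : 0 <= c * (t - p) by rewrite mulr_ge0 // subr_ge0 (le_trans ps).
have h1 : c * (t - s) <= c * (t - p) by rewrite ler_wpM2l // lerD2l lerN2.
have h2 : c * (s - p) <= c * (t - p) by rewrite ler_wpM2l // lerD2r.
set K := invmx (X p) *m X s - 1%:M; set S := invmx (X s) *m X t - 1%:M.
have -> : invmx (X p) *m (X t - X s) = (1%:M + K) *m S.
  rewrite /K [1%:M + _]addrC subrK /S !mulmxBr mulmx1 -mulmxA mulKVmx //.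
have /andP[lo up_] : (1 - 2 * c * (t - s)) * (t - s) <= nrm S <= (1 + 2 * c * (t - s)) * (t - s).
  by apply: minimal_step => //; lra.
have /andP[_ hK] : (1 - 2 * c * (s - p)) * (s - p) <= nrm K <= (1 + 2 * c * (s - p)) * (s - p).
  by apply: minimal_step => //; lra.
have sp : 0 <= s - p by rewrite subr_ge0.
have ts : 0 <= t - s by rewrite subr_ge0.
have cs0 : 0 <= c * (s - p) by rewrite mulr_ge0.
have ct0 : 0 <= c * (t - s) by rewrite mulr_ge0.
have cK : c * nrm K <= 2 * (c * (t - p)).
  have : c * nrm K <= c * (2 * (s - p)).
    apply: ler_wpM2l => //; apply: (le_trans hK); apply: ler_wpM2r => //; lra.
  lra.
have nS := nrm_ge0 g S; have nK := nrm_ge0 g K.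
set x := c * (t - p) in ce h1 h2 cK.
have e5 : 5 * c * (t - p) = 5 * x by rewrite /x; lra.
rewrite e5 in h *.
have up2 : nrm S <= (1 + 2 * x) * (t - s).
  by apply: (le_trans up_); apply: ler_wpM2r => //; lra.
have lo2 : (1 - 2 * x) * (t - s) <= nrm S.
  by apply: le_trans lo; apply: ler_wpM2r => //; lra.
apply/andP; split.
  apply: le_trans (nrm_mul1D_ge g K S).
  apply: (@le_trans _ _ ((1 - 2 * x) * ((1 - 2 * x) * (t - s)))).
    by rewrite mulrA ler_wpM2r //; nra.
  apply: ler_pM => //; [lra|rewrite mulr_ge0 //; lra|lra].
apply: (le_trans (nrm_mul1D g K S)).
apply: (@le_trans _ _ ((1 + 2 * x) * ((1 + 2 * x) * (t - s)))).
  apply: ler_pM => //; [rewrite addr_ge0 ?mulr_ge0 //|lra].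
by rewrite mulrA ler_wpM2r //; nra.
Qed.

End estimates.

(* Near-additivity of the lengths of two consecutive chords forces them to be
   almost parallel, by the parallelogram identity. *)
Lemma chord_slopes (a b : 'M[R]_n) (p q e : R) : 0 < p -> 0 < q -> 0 <= e <= 1 ->
  nrm a <= (1 + e) * p -> nrm b <= (1 + e) * q -> (1 - e) * (p + q) <= nrm (a + b) ->
  nrm (p^-1 *: a - (p + q)^-1 *: (a + b)) ^+ 2 <= 4 * e * (q / p).
Proof.
move=> p0 q0 /andP[e0 e1] ha hb hab; have pq0 : 0 < p + q by rewrite addr_gt0.
have pne : p != 0 by rewrite gt_eqF.
have pqne : p + q != 0 by rewrite gt_eqF.
have -> : p^-1 *: a - (p + q)^-1 *: (a + b) = (p * (p + q))^-1 *: (q *: a + - p *: b).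
  rewrite !scalerDr !scalerA opprD addrA -scalerBl -scaleNr.
  by congr (_ *: _ + _ *: _); field; rewrite pne pqne.
rewrite nrmZ exprMn sqr_nrmD !nrmZ !innerZl !innerZr !exprMn.
have sq (x y : R) : 0 <= x -> x <= y -> x ^+ 2 <= y ^+ 2 by move=> *; nra.
have A2 := sq _ _ (nrm_ge0 g a) ha; have B2 := sq _ _ (nrm_ge0 g b) hb.
have AB2 : ((1 - e) * (p + q)) ^+ 2 <= nrm (a + b) ^+ 2.
  by apply: sq => //; rewrite mulr_ge0 ?subr_ge0 // ltW.
rewrite sqr_nrmD in AB2.
have -> : `|(p * (p + q))^-1| ^+ 2 = (p ^+ 2 * (p + q) ^+ 2)^-1.
  by rewrite -normrX ger0_norm ?sqr_ge0 // exprVn exprMn.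
have -> : `|q| ^+ 2 = q ^+ 2 by rewrite -normrX ger0_norm ?sqr_ge0.
have -> : `|- p| ^+ 2 = p ^+ 2 by rewrite normrN -normrX ger0_norm ?sqr_ge0.
rewrite mulrC ler_pdivrMr ?mulr_gt0 ?exprn_gt0 //.
have -> : 4 * e * (q / p) * (p ^+ 2 * (p + q) ^+ 2) = p * q * ((p + q) ^+ 2 * (4 * e)).
  by field.
set u := nrm a ^+ 2 in A2 AB2 *; set v := nrm b ^+ 2 in B2 AB2 *; set w := g a b in AB2 *.
(* The square of [q a - p b] is [q (p + q) u + p (p + q) v - p q (u + 2 w + v)]; the three bounds
   combine through [(1 + e) ^ 2 - (1 - e) ^ 2 = 4 e]. *)
have h1 : q * (p + q) * u <= q * (p + q) * ((1 + e) * p) ^+ 2.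
  by rewrite ler_wpM2l // mulr_ge0 // ltW.
have h2 : p * (p + q) * v <= p * (p + q) * ((1 + e) * q) ^+ 2.
  by rewrite ler_wpM2l // mulr_ge0 // ltW.
have h3 : p * q * ((1 - e) * (p + q)) ^+ 2 <= p * q * (u + 2 * w + v).
  by rewrite ler_wpM2l // mulr_ge0 // ltW.
lra.
Qed.

End minimal_curve.

(* The ratio 4 makes [sqrt y] halve at each scale, so the errors sum up to twice
   the first one. *)
Lemma quarter_scale (R : realType) (G : R -> R) (m K : R) : 0 <= K ->
  (forall x y, 0 < x -> x < y -> y <= m -> y <= 4 * x -> `|G x - G y| <= K * Num.sqrt y) ->
  forall x y, 0 < x -> x < y -> y <= m -> `|G x - G y| <= 2 * K * Num.sqrt y.
Proof.
move=> K0 h.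
have dir x y : 0 < x -> x < y -> y <= m -> y <= 4 * x -> `|G x - G y| <= 2 * K * Num.sqrt y.
  move=> x0 xy ym y4; apply: (le_trans (h _ _ x0 xy ym y4)); rewrite ler_wpM2r ?sqrtr_ge0 //; lra.
have key k : forall x y, 0 < x -> x < y -> y <= m -> y <= 4 ^+ k.+1 * x ->
    `|G x - G y| <= 2 * K * Num.sqrt y.
  elim: k => [|k IH] x y x0 xy ym yx; first exact: dir.
  have [y4|y4] := leP y (4 * x); first exact: dir.
  have y0 : 0 < y by exact: lt_trans xy.
  pose z := y / 4.
  have xz : x < z by rewrite /z; lra.
  have zm : z <= m by rewrite /z; lra.
  have z0 : 0 < z by exact: lt_trans xz.
  have h1 : `|G x - G z| <= 2 * K * Num.sqrt z.
    by apply: IH => //; rewrite exprS in yx; rewrite /z; lra.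
  have h2 : `|G z - G y| <= K * Num.sqrt y.
    by apply: h => //; rewrite /z; lra.
  have sz : Num.sqrt y = 2 * Num.sqrt z.
    have -> : y = 2 ^+ 2 * z by rewrite /z; field.
    by rewrite sqrtrM ?sqr_ge0 // sqrtr_sqr ger0_norm.
  have := ler_normD (G x - G z) (G z - G y); rewrite addrA subrK.
  by rewrite sz in h2 *; lra.
move=> x y x0 xy ym; have y0 : 0 < y by exact: lt_trans xy.
have [k hk] : exists k : nat, y / x < k%:R.
  exists (Num.truncn (y / x)).+1; exact: truncnS_gt.
apply: (key k) => //; rewrite -ler_pdivrMr //; apply/ltW/(lt_le_trans hk).
rewrite -natrX ler_nat; apply: ltnW; apply: ltn_trans (ltnSn k) _.
exact: ltn_expl.
Qed.

(** * Convergence of difference quotients of a real function *)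

Section slopes.
Variables (R : realType).

Definition slope (f : R -> R) (s t : R) : R := (t - s)^-1 * (f t - f s).

Lemma slopeC f s t : slope f s t = slope f t s.
Proof. by rewrite /slope -[t - s]opprB invrN mulNr -mulrN opprB. Qed.

Variables (f : R -> R) (a b d K : R).
Hypotheses (ab : a < b) (d0 : 0 < d) (K0 : 0 <= K).
Hypothesis slopeR : forall s t u, a <= s -> s < t -> t < u -> u <= b -> u - s <= d ->
  u - s <= 4 * (t - s) -> `|slope f s t - slope f s u| <= K * Num.sqrt (u - s).
Hypothesis slopeL : forall s t u, a <= s -> s < t -> t < u -> u <= b -> u - s <= d ->
  u - s <= 4 * (u - t) -> `|slope f t u - slope f s u| <= K * Num.sqrt (u - s).

(** [quarter_scale] with the left end fixed removes the restriction to subintervals of at least a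
    quarter of the length. *)
Let slopeR2 s t u : a <= s -> s < t -> t <= u -> u <= b -> u - s <= d ->
  `|slope f s t - slope f s u| <= 2 * K * Num.sqrt (u - s).
Proof.
move=> as_ st; rewrite le_eqVlt => /orP[/eqP-> _ _|tu ub_ us].
  by rewrite subrr normr0 !mulr_ge0 ?sqrtr_ge0.
have := @quarter_scale R (fun x => slope f s (s + x)) (u - s) K K0 _ (t - s) (u - s).
rewrite !(addrC s) !subrK; apply; rewrite ?subr_gt0 ?ltrD2r ?lerD2r // ?ltrD2r //.
move=> x y x0 xy yus y4; have -> : y = (s + y) - s by rewrite addrAC subrr add0r.
rewrite addrAC subrr add0r.
have := @slopeR s (s + x) (s + y); rewrite [s + y - s]addrAC [s + x - s]addrAC !subrr !add0r.
rewrite !(addrC s); apply => //; rewrite ?ltrDr ?ltrD2l ?ltrD2r //; lra.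
Qed.

Let slopeL2 s t u : a <= s -> s <= t -> t < u -> u <= b -> u - s <= d ->
  `|slope f t u - slope f s u| <= 2 * K * Num.sqrt (u - s).
Proof.
move=> as_; rewrite le_eqVlt => /orP[/eqP-> _ _ _|st tu ub_ us].
  by rewrite subrr normr0 !mulr_ge0 ?sqrtr_ge0.
have := @quarter_scale R (fun x => slope f (u - x) u) (u - s) K K0 _ (u - t) (u - s).
rewrite !subKr; apply; rewrite ?subr_gt0 ?ltrD2l ?ltrN2 //.
move=> x y x0 xy yus y4.
have := @slopeL (u - y) (u - x) u; rewrite !subKr; apply => //; lra.
Qed.

(** The interval grows one end at a time, from [[p, q]] to [[p, u]] to [[s, u]]. *)
Let slope_nest s p q u : a <= s -> s <= p -> p < q -> q <= u -> u <= b -> u - s <= d ->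
  `|slope f p q - slope f s u| <= 4 * K * Num.sqrt (u - s).
Proof.
move=> as_ sp pq qu ub_ us.
have h1 : `|slope f p q - slope f p u| <= 2 * K * Num.sqrt (u - p).
  by apply: slopeR2 => //; lra.
have h2 : `|slope f p u - slope f s u| <= 2 * K * Num.sqrt (u - s).
  by apply: slopeL2 => //; lra.
have h3 : Num.sqrt (u - p) <= Num.sqrt (u - s) by apply: ler_wsqrtr; lra.
have h4 := ler_wpM2l (mulr_ge0 (ler0n R 2) K0) h3.
have := ler_normD (slope f p q - slope f p u) (slope f p u - slope f s u).
rewrite addrA subrK; lra.
Qed.

Let slope_hull m M s t : a <= m -> M <= b -> M - m <= d ->
  m <= s <= M -> m <= t <= M -> s != t ->
  `|slope f t s - slope f m M| <= 4 * K * Num.sqrt (M - m).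
Proof.
move=> am Mb Mm /andP[ms sM] /andP[mt tM]; rewrite neq_lt => /orP[st|ts].
  by rewrite slopeC; apply: slope_nest.
exact: slope_nest.
Qed.

Let slope_close t s s' r : a <= t <= b -> a <= s <= b -> a <= s' <= b -> 2 * r <= d ->
  `|s - t| <= r -> `|s' - t| <= r -> s != t -> s' != t ->
  `|slope f t s - slope f t s'| <= 8 * K * Num.sqrt (2 * r).
Proof.
move=> /andP[at_ tb] /andP[as_ sb] /andP[as' s'b] rd hs hs' st s't.
have [/andP[h1 h2] /andP[h3 h4]] : - r <= s - t <= r /\ - r <= s' - t <= r.
  by rewrite -!ler_norml.
pose m := Num.min t (Num.min s s'); pose M := Num.max t (Num.max s s').
have am : a <= m by rewrite !le_min at_ as_ as'.
have Mb : M <= b by rewrite !ge_max tb sb s'b.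
have mt : m <= t <= M by rewrite ge_min le_max lexx.
have ms : m <= s <= M by rewrite !ge_min !le_max lexx !orbT.
have ms' : m <= s' <= M by rewrite !ge_min !le_max lexx !orbT.
have Mm : M - m <= 2 * r.
  rewrite lerBlDr !ge_max; apply/and3P; split; rewrite -lerBlDl /m !le_min.
  - by apply/and3P; split; lra.
  - by apply/and3P; split; lra.
  - by apply/and3P; split; lra.
have Md : M - m <= d by apply: le_trans rd.
have e1 := slope_hull am Mb Md ms mt st; have e2 := slope_hull am Mb Md ms' mt s't.
have h := ler_wpM2l (mulr_ge0 (ler0n R 4) K0) (ler_wsqrtr Mm).
have := ler_normB (slope f t s - slope f m M) (slope f t s' - slope f m M).
rewrite opprB addrA subrK; lra.
Qed.

(** The slopes towards points [t + v k] tending to [t] are bounded, hence converge along an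
    ultrafilter; [slope_close] makes this value the limit of all slopes at [t], with a rate. *)
Lemma slope_limit : exists D : R -> R, forall t s, a <= t <= b -> a <= s <= b -> s != t ->
  2 * `|s - t| <= d -> `|slope f t s - D t| <= 8 * K * Num.sqrt (2 * `|s - t|).
Proof.
have [U [UU UN]] := @ultraFilterLemma nat \oo _.
have UF : ProperFilter U by case: UU.
suff /choice[D hD] t : exists y : R, a <= t <= b -> forall s, a <= s <= b -> s != t ->
    2 * `|s - t| <= d -> `|slope f t s - y| <= 8 * K * Num.sqrt (2 * `|s - t|).
  by exists D => t s /hD + ? ? ?; apply.
have [tab|] := boolP (a <= t <= b); last by exists 0.
have /andP[at_ tb] := tab.
pose h := Num.min ((b - a) / 2) (d / 2).
have h0 : 0 < h by rewrite lt_min !divr_gt0 ?subr_gt0.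
have hba : h <= (b - a) / 2 by rewrite ge_min lexx.
have hd2 : h <= d / 2 by rewrite ge_min lexx orbT.
have hd : 2 * h <= d by lra.
(* Points of the left half move right and the others left, by at most half the length, so [t + v k]
   stays in the interval. *)
pose v (k : nat) : R := (if t <= (a + b) / 2 then h else - h) / k.+1%:R.
have nv k : `|v k| = h / k.+1%:R.
  rewrite /v normrM normfV normr_nat; case: ifP; rewrite ?normrN ger0_norm // ltW //.
have vh k : `|v k| <= h by rewrite nv ler_pdivrMr ?ltr0Sn // ler_peMr ?ler1n // ltW.
have vab k : a <= t + v k <= b.
  have := vh k; rewrite ler_norml => /andP[v1 v2].
  have : if t <= (a + b) / 2 then 0 <= v k else v k <= 0.
    rewrite /v; case: (t <= _); first by rewrite divr_ge0 ?(ltW h0).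
    by rewrite mulNr oppr_le0 divr_ge0 ?(ltW h0).
  by case: leP => ? ?; apply/andP; split; lra.
have vt k : t + v k != t.
  by rewrite -subr_eq0 addrAC subrr add0r -normr_gt0 nv divr_gt0 // ltr0Sn.
have vd k : `|t + v k - t| = `|v k| by rewrite addrAC subrr add0r.
have [y hy] : exists y : R, slope f t (t + v k) @[k --> U] --> y.
  apply: (@ultra_cvg_bounded _ _ _ _ _ (8 * K * Num.sqrt (2 * h) + `|slope f t (t + v 0%N)|)) => k.
  rewrite -[X in `|X|](subrK (slope f t (t + v 0%N))) (le_trans (ler_normD _ _)) //.
  by rewrite lerD2r; apply: slope_close => //; rewrite vd.
exists y => _ s sab st sd.
have l1 : `|slope f t s - slope f t (t + v k)| @[k --> U] --> `|slope f t s - y|.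
  by apply: cvg_norm; apply: cvgB => //; exact: cvg_cst.
apply: (ler_cvg_to l1 (cvg_cst _)).
apply: UN; have e0 : 0 < `|s - t| / h by rewrite divr_gt0 // normr_gt0 subr_eq0.
(* Beyond this index [|v k| <= |s - t|], so [slope_close] applies with radius [|s - t|]. *)
exists (Num.truncn (`|s - t| / h)^-1) => // k /= hk.
apply: slope_close => //; rewrite vd nv ler_pdivrMr ?ltr0Sn // mulrC -ler_pdivrMr //; last by rewrite normr_gt0 subr_eq0.
have -> : h / `|s - t| = (`|s - t| / h)^-1 by rewrite invf_div.
apply: ltW; apply: (lt_le_trans (truncnS_gt _)).
by rewrite ler_nat ltnS.
Qed.

End slopes.

(** * Limits relative to an interval, in terms of radii *)

Section within_filters.
Variable R : realType.

Lemma near_within_dnbhs (A : set R) (t r : R) (P : R -> Prop) : 0 < r ->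
  (forall s, A s -> s != t -> `|s - t| < r -> P s) -> \forall s \near within A t^', P s.
Proof.
move=> r0 h; apply/nbhs_ballP; exists r => //= s; rewrite /ball /= distrC => hs st As.
exact: h.
Qed.

Lemma near_within_nbhs (A : set R) (t r : R) (P : R -> Prop) : 0 < r ->
  (forall s, A s -> `|s - t| < r -> P s) -> \forall s \near within A (nbhs t), P s.
Proof.
move=> r0 h; apply/nbhs_ballP; exists r => //= s; rewrite /ball /= distrC => hs As.
exact: h.
Qed.

Lemma within_dnbhs_near (A : set R) (t : R) (P : R -> Prop) :
  (\forall s \near within A t^', P s) ->
  exists2 r : R, 0 < r & forall s, A s -> s != t -> `|s - t| < r -> P s.
Proof.
move=> /nbhs_ballP[r /= r0 h]; exists r => // s As st hs; apply: h => //.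
by rewrite /ball /= distrC.
Qed.

Lemma within_nbhs_near (A : set R) (t : R) (P : R -> Prop) :
  (\forall s \near within A (nbhs t), P s) ->
  exists2 r : R, 0 < r & forall s, A s -> `|s - t| < r -> P s.
Proof.
move=> /nbhs_ballP[r /= r0 h]; exists r => // s As hs; apply: h => //.
by rewrite /ball /= distrC.
Qed.

Lemma small_sqrt (K e m : R) : 0 <= K -> 0 < e -> 0 < m ->
  exists2 r : R, 0 < r <= m & forall h, 0 <= h -> h <= r -> K * Num.sqrt h <= e.
Proof.
move=> K0 e0 m0; have K1 : 0 < K + 1 by rewrite ltr_wpDl.
pose q := e / (K + 1); have q0 : 0 < q by rewrite divr_gt0.
exists (Num.min m (q ^+ 2)); first by rewrite lt_min m0 exprn_gt0 //= ge_min lexx.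
move=> h h0; rewrite le_min => /andP[_ hq].
have : Num.sqrt h <= q by rewrite -(ger0_norm (ltW q0)) -sqrtr_sqr ler_wsqrtr.
move=> /(ler_wpM2l K0) /le_trans; apply.
by rewrite /q mulrA ler_pdivrMr // mulrC ler_wpM2l ?ltW // ltrDl.
Qed.

End within_filters.

(** * Differentiability of a minimal curve *)

Section regularity.
Variables (R : realType) (n : nat) (g : inner_norm R n).
Local Notation c := (icst g).
Local Notation step := (step g).
Local Notation nrm := (nrm g).

(** [step_sym] bounds [step (f x) a] by twice [step a (f x)], which tends to 0; hence
    [invmx (f x) *m a] tends to 1. *)
Lemma cvg_invmx T (F : set_system T) {FF : Filter F} (f : T -> 'M[R]_n) (a : 'M[R]_n) :
  a \in unitmx -> f @ F --> a -> invmx (f x) @[x --> F] --> invmx a.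
Proof.
move=> ua fa; have c0 := icst_gt0 g.
have sa : step a (f x) @[x --> F] --> (0 : R).
  rewrite -(stepxx g ua); apply: cvg_nrm; apply: cvgB; last exact: cvg_cst.
  by apply: cvg_mulmx => //; exact: cvg_cst.
have l1 : invmx (f x) *m a @[x --> F] --> (1%:M : 'M[R]_n).
  apply/cvgrPdistC_le => e e0.
  pose k := Num.min (1 / 2 / c) (e / (2 * c)).
  have k0 : 0 < k by rewrite lt_min !divr_gt0 // mulr_gt0.
  move/cvgrPdistC_le: sa => /(_ k k0); apply: filterS => x.
  rewrite subr0 ger0_norm ?step_ge0 // le_min => /andP[h1 h2].
  have h1' : c * step a (f x) <= 1 / 2 by rewrite mulrC -ler_pdivlMr.
  have ux : f x \in unitmx by apply: (unitmx_near (g := g) ua); lra.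
  apply: (le_trans (norm_le_nrm g _)); have := step_sym ua ux h1'; rewrite {1}/step => h3.
  apply: le_trans (ler_wpM2l (ltW c0) h3) _.
  by move: h2; rewrite ler_pdivlMr ?mulr_gt0 //; lra.
have l2 : invmx (f x) *m a *m invmx a @[x --> F] --> 1%:M *m invmx a.
  by apply: cvg_mulmx => //; exact: cvg_cst.
rewrite mul1mx in l2; apply: cvg_trans l2.
by apply: near_eq_cvg; apply: filterE => x; rewrite mulmxK.
Qed.

Variables (l : R) (X : R -> 'M[R]_n).
Hypotheses (l0 : 0 < l) (mX : minimal_curve g l X).
Let c0 : 0 < c := icst_gt0 g.
Let c0' : 0 <= c := icst_ge0 g.

(** Growth is controlled forwards in time only: [X s] is reached from [X 0], but [invmx (X s)] is
    bounded through the increment from [X s] to the final point [X l]. *)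
Lemma minimal_bounded : exists2 b : R, 1 <= b & forall s, 0 <= s -> s <= l ->
  nrm (X s) <= b /\ nrm (invmx (X s)) <= b.
Proof.
pose C := expR (c * l) / c + nrm 1%:M.
have C0 : 0 <= C by rewrite addr_ge0 ?nrm_ge0 // divr_ge0 // expR_ge0.
have u0 := minimal_unit mX (lexx 0) (ltW l0).
have ul := minimal_unit mX (ltW l0) (lexx l).
have bd (s t : R) : 0 <= s -> s <= t -> t <= l -> nrm (invmx (X s) *m X t) <= C.
  move=> s0 st tl; case: mX => _ /(_ s t s0 st tl) gr _.
  rewrite -[X in nrm X](subrK 1%:M) (le_trans (nrmD g _ _)) // lerD2r.
  rewrite ler_pdivlMr // mulrC; set r := nrm _ in gr *.
  have : expR (c * (t - s)) <= expR (c * l) by rewrite ler_expR ler_wpM2l //; lra.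
  have -> : r = step (X s) (X t) by []. lra.
exists (1 + c * (nrm (X 0) * C) + c * (C * nrm (invmx (X l)))).
  by rewrite -addrA lerDl addr_ge0 // !mulr_ge0 // nrm_ge0.
move=> s s0 sl; have us := minimal_unit mX s0 sl.
have p1 : 0 <= c * (nrm (X 0) * C) by rewrite !mulr_ge0 // nrm_ge0.
have p2 : 0 <= c * (C * nrm (invmx (X l))) by rewrite !mulr_ge0 // nrm_ge0.
split.
  have : nrm (X s) <= c * (nrm (X 0) * C).
    rewrite -[X s](mulKVmx u0) (le_trans (nrm_mulmx g _ _)) //.
    by rewrite ler_wpM2l // ler_wpM2l ?nrm_ge0 // bd.
  lra.
have : nrm (invmx (X s)) <= c * (C * nrm (invmx (X l))).
  rewrite -[invmx (X s)](mulmxK ul) (le_trans (nrm_mulmx g _ _)) //.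
  by rewrite ler_wpM2l // ler_wpM2r ?nrm_ge0 // bd.
lra.
Qed.

Definition quot (X : R -> 'M[R]_n) (s t : R) := (t - s)^-1 *: (X t - X s).

Lemma minimal_speed s t : 0 <= s -> s < t -> t <= l -> 5 * c * (t - s) <= 1 ->
  `|nrm (invmx (X s) *m quot X s t) - 1| <= 5 * c * (t - s).
Proof.
move=> s0 st tl h; have ts0 : 0 < t - s by rewrite subr_gt0.
have := minimal_chord mX s0 (lexx s) (ltW st) tl h.
rewrite /quot -scalemxAr nrmZ [`|(t - s)^-1|]gtr0_norm ?invr_gt0 // => /andP[h1 h2].
rewrite ler_norml; apply/andP; split.
  by rewrite lerBrDr -(ler_pM2r ts0) [(t - s)^-1 * _ * _]mulrAC mulVf ?gt_eqF // mul1r addrC.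
by rewrite lerBlDr -(ler_pM2r ts0) [(t - s)^-1 * _ * _]mulrAC mulVf ?gt_eqF // mul1r [_ + 1]addrC.
Qed.

Lemma minimal_quot : exists K : R, 0 <= K /\ forall s t u, 0 <= s -> s < t -> t < u -> u <= l ->
  u - s <= 1 / (5 * c) ->
  (u - s <= 4 * (t - s) -> `|quot X s t - quot X s u| <= K * Num.sqrt (u - s)) /\
  (u - s <= 4 * (u - t) -> `|quot X t u - quot X s u| <= K * Num.sqrt (u - s)).
Proof.
have [b b1 hb] := minimal_bounded.
have b0 : 0 <= b by lra.
have cb : 0 <= c * (c * b) by rewrite !mulr_ge0.
(* [60 = 4 * 5 * 3]: the 4 is that of [chord_slopes], [5 * c * (u - s)] is the relative error in
   [minimal_chord], and 3 bounds the ratio of the two durations when the relevant one is at least a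
   quarter of the total. *)
exists (c * (c * b) * Num.sqrt (60 * c)); split; first by rewrite mulr_ge0 ?sqrtr_ge0.
move=> s t u s0 st tu ul us; have su := lt_trans st tu.
have sl : s <= l by lra.
have c5 : 0 < 5 * c by rewrite mulr_gt0.
have h5 : 5 * c * (u - s) <= 1 by rewrite mulrC -ler_pdivlMr.
have e0 : 0 <= 5 * c * (u - s) by rewrite mulr_ge0 ?ltW // subr_gt0.
have us1 := minimal_unit mX s0 sl.
pose a := invmx (X s) *m (X t - X s); pose b' := invmx (X s) *m (X u - X t).
have ab : a + b' = invmx (X s) *m (X u - X s).
  by rewrite /a /b' -mulmxDr addrC addrA subrK.
have p0 : 0 < t - s by rewrite subr_gt0.
have q0 : 0 < u - t by rewrite subr_gt0.
have pq : t - s + (u - t) = u - s by rewrite addrC addrA subrK.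
have h5' : 5 * c * (t - s) <= 5 * c * (u - s) by apply: ler_wpM2l; [exact: ltW|lra].
have ha : nrm a <= (1 + 5 * c * (u - s)) * (t - s).
  have /andP[_ h] := minimal_chord mX s0 (lexx s) (ltW st) (ltW (lt_le_trans tu ul)) (le_trans h5' h5).
  by apply: (le_trans h); apply: ler_wpM2r; [exact: ltW|rewrite lerD2l].
have hbb : nrm b' <= (1 + 5 * c * (u - s)) * (u - t).
  by have /andP[_ h] := minimal_chord mX s0 (ltW st) (ltW tu) ul h5.
have hab : (1 - 5 * c * (u - s)) * (u - s) <= nrm (a + b').
  by rewrite ab; have /andP[] := minimal_chord mX s0 (lexx s) (ltW su) ul h5.
have fin (M M' : 'M[R]_n) (w : R) : M = X s *m M' -> w <= 3 ->
    nrm M' ^+ 2 <= 4 * (5 * c * (u - s)) * w ->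
    `|M| <= c * (c * b) * Num.sqrt (60 * c) * Num.sqrt (u - s).
  move=> -> w3 h; apply: (le_trans (norm_le_nrm g _)).
  have h1 : nrm M' <= Num.sqrt (60 * c) * Num.sqrt (u - s).
    rewrite -sqrtrM ?mulr_ge0 // -[nrm M']ger0_norm ?nrm_ge0 // -sqrtr_sqr ler_wsqrtr //.
    apply: (le_trans h); have := ler_wpM2l e0 w3; lra.
  rewrite -!mulrA; apply: ler_wpM2l => //; apply: (le_trans (nrm_mulmx g _ _)).
  apply: ler_wpM2l => //; apply: ler_pM; rewrite ?nrm_ge0 //; first by case: (hb s s0 sl).
have XE (k : R) (v w : R) : k *: (X v - X w) = X s *m (k *: (invmx (X s) *m (X v - X w))).
  by rewrite -scalemxAr mulKVmx.
split=> h4.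
  apply: (fin _ ((t - s)^-1 *: a - (t - s + (u - t))^-1 *: (a + b')) ((u - t) / (t - s))).
  - by rewrite mulmxBr pq ab -!XE.
  - by rewrite ler_pdivrMr //; lra.
  - by apply: chord_slopes; rewrite ?e0 // pq.
apply: (fin _ ((u - t)^-1 *: b' - (u - t + (t - s))^-1 *: (b' + a)) ((t - s) / (u - t))).
- by rewrite mulmxBr [u - t + _]addrC pq [b' + a]addrC ab -!XE.
- by rewrite ler_pdivrMr //; lra.
- by apply: chord_slopes; rewrite ?e0 // [u - t + _]addrC pq [b' + a]addrC.
Qed.

Lemma minimal_derivative : exists D : R -> 'M[R]_n, exists K d : R,
  [/\ 0 <= K, 0 < d & forall t s, 0 <= t <= l -> 0 <= s <= l -> s != t ->
    `|s - t| <= d -> `|quot X t s - D t| <= K * Num.sqrt `|s - t|].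
Proof.
have [K [K0 hK]] := minimal_quot.
pose d := 1 / (5 * c); have d0 : 0 < d by rewrite divr_gt0 // mulr_gt0.
have qE i j s t : slope (fun t => X t i j) s t = quot X s t i j.
  by rewrite /slope /quot !mxE.
have /choice[D hD] (ij : 'I_n * 'I_n) : exists D : R -> R,
    forall t s, 0 <= t <= l -> 0 <= s <= l -> s != t -> 2 * `|s - t| <= d ->
      `|slope (fun t => X t ij.1 ij.2) t s - D t| <= 8 * K * Num.sqrt (2 * `|s - t|).
  apply: slope_limit => // s t u s0 st tu ul us h4; rewrite !qE.
    have [h _] := hK s t u s0 st tu ul us; apply: le_trans (h h4).
    by have := entry_le_norm (quot X s t - quot X s u) ij.1 ij.2; rewrite !mxE.
  have [_ h] := hK s t u s0 st tu ul us; apply: le_trans (h h4).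
  by have := entry_le_norm (quot X t u - quot X s u) ij.1 ij.2; rewrite !mxE.
exists (fun t => \matrix_(i, j) D (i, j) t), (8 * K * Num.sqrt 2), (d / 2).
split; [by rewrite !mulr_ge0 ?sqrtr_ge0|by rewrite divr_gt0|move=> t s ht hs st sd].
apply: norm_le_entries => [|i j]; first by rewrite !mulr_ge0 ?sqrtr_ge0.
rewrite -mulrA -sqrtrM //.
have -> : (quot X t s - \matrix_(i, j) D (i, j) t) i j = quot X t s i j - D (i, j) t.
  by rewrite !mxE.
by rewrite -qE; apply: (hD (i, j)) => //=; lra.
Qed.

End regularity.

Section regular_derivative.
Variables (R : realType) (n : nat).

Lemma derive1_within (a b t : R) (Y : R -> 'M[R]_n) (L : 'M[R]_n) : a < t < b ->
  (s - t)^-1 *: (Y s - Y t) @[s --> within `[a, b] t^'] --> L -> derive1 Y t = L.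
Proof.
move=> /andP[at_ tb] /cvgrPdist_le h; apply/cvg_lim => //.
apply/cvgrPdist_le => e e0.
have [r r0 hr] := within_dnbhs_near (h e e0).
pose m := Num.min r (Num.min (t - a) (b - t)).
have m0 : 0 < m by rewrite !lt_min r0 !subr_gt0 at_.
apply/nbhs_ballP; exists m => //= k; rewrite /ball /= sub0r normrN => km k0.
move: km; rewrite !lt_min => /and3P[kr ka kb].
have := hr (k + t); rewrite addrK; apply => //.
- rewrite /= in_itv /=; move: ka kb; rewrite !ltr_norml => /andP[? ?] /andP[? ?].
  by apply/andP; split; lra.
- by rewrite -subr_eq0 addrK.
Qed.

End regular_derivative.

(** * Admissibility and length of a minimal curve *)

Section minimal_is_admissible.
Variables (R : realType) (n : nat) (g : inner_norm R n) (l : R) (X : R -> 'M[R]_n).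
Hypotheses (l0 : 0 < l) (mX : minimal_curve g l X).
Local Notation c := (icst g).
Local Notation nrm := (nrm g).
Let c0 : 0 < c := icst_gt0 g.
Let c0' : 0 <= c := icst_ge0 g.

Lemma nrm_dist x y : `|nrm x - nrm y| <= nrm (x - y).
Proof.
rewrite ler_norml; apply/andP; split.
  have := nrmD g (y - x) x; rewrite subrK -[nrm (y - x)]nrmN opprB; lra.
by have := nrmD g (x - y) y; rewrite subrK; lra.
Qed.

Section with_derivative.
Variables (D : R -> 'M[R]_n) (K d : R).
Hypotheses (K0 : 0 <= K) (d0 : 0 < d).
Hypothesis hD : forall t s, 0 <= t <= l -> 0 <= s <= l -> s != t ->
    `|s - t| <= d -> `|quot X t s - D t| <= K * Num.sqrt `|s - t|.

Lemma minimal_cvg_quot t : 0 <= t <= l ->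
  (s - t)^-1 *: (X s - X t) @[s --> within `[0, l] t^'] --> D t.
Proof.
move=> ht; apply/cvgrPdistC_le => e e0.
have [r /andP[r0 rd] hr] := small_sqrt K0 e0 d0.
apply: (near_within_dnbhs r0) => s; rewrite /= in_itv /= => hs st sr.
apply: (le_trans (hD ht hs st (le_trans (ltW sr) rd))).
by apply: hr => //; exact: ltW.
Qed.

Lemma quotC s t : quot X s t = quot X t s.
Proof. by rewrite /quot -[t - s]opprB invrN scaleNr -scalerN opprB. Qed.

Lemma minimal_derivative_continuous : {within `[0, l], continuous D}.
Proof.
apply/subspace_continuousP => t; rewrite /= in_itv /= => ht.
apply/cvgrPdist_le => e e0.
have e2 : 0 < e / 2 by rewrite divr_gt0.
have [r /andP[r0 rd] hr] := small_sqrt K0 e2 d0.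
apply: (near_within_nbhs r0) => s; rewrite /= in_itv /= => hs sr.
have [->|st] := eqVneq s t; first by rewrite subrr normr0 ltW.
have h1 := hD ht hs st (le_trans (ltW sr) rd).
have h2 := hD hs ht; rewrite eq_sym distrC quotC in h2.
have h2' := h2 st (le_trans (ltW sr) rd).
have h3 := hr _ (normr_ge0 (s - t)) (ltW sr).
have := ler_normD (D t - quot X t s) (quot X t s - D s); rewrite addrA subrK.
rewrite [`|D t - quot _ _ _|]distrC; lra.
Qed.

Lemma minimal_continuous : {within `[0, l], continuous X}.
Proof.
apply/subspace_continuousP => t; rewrite /= in_itv /= => ht.
apply/cvgrPdistC_le => e e0.
pose M := `|D t| + K * Num.sqrt d + 1.
have M0 : 0 < M by rewrite ltr_wpDl // addr_ge0 // mulr_ge0 // sqrtr_ge0.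
have r0 : 0 < Num.min d (e / M) by rewrite lt_min d0 divr_gt0.
apply: (near_within_nbhs r0) => s; rewrite /= in_itv /= lt_min => hs /andP[sd se].
have [->|st] := eqVneq s t; first by rewrite subrr normr0 ltW.
have h1 := hD ht hs st (ltW sd).
have sq : Num.sqrt `|s - t| <= Num.sqrt d by rewrite ler_wsqrtr // ltW.
have h2 : `|quot X t s| <= M.
  have := ler_normD (quot X t s - D t) (D t); rewrite subrK /M.
  have := ler_wpM2l K0 sq; lra.
have -> : X s - X t = (s - t) *: quot X t s.
  by rewrite /quot scalerA mulfV ?scale1r // subr_eq0.
rewrite normrZ; apply: (@le_trans _ _ (`|s - t| * M)); first by rewrite ler_wpM2l.
by rewrite -ler_pdivlMr // ltW.
Qed.

(** [minimal_speed] reads a chord in the frame of its left end, hence [t < l]: a short chord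
    starting at [t] has speed close to 1 and slope close to [D t]. *)
Lemma minimal_unit_speed t : 0 <= t -> t < l -> nrm (invmx (X t) *m D t) = 1.
Proof.
move=> t0 tl; have [b b1 hb] := minimal_bounded l0 mX.
apply/eqP; rewrite -subr_eq0 -normr_le0; apply/ler_addgt0Pr => e e0; rewrite add0r.
have K'0 : 0 <= c * (b * (c * K)) by rewrite !mulr_ge0 //; lra.
have e2 : 0 < e / 2 by rewrite divr_gt0.
pose m := Num.min (Num.min d (l - t)) (Num.min (1 / (5 * c)) (e / 2 / (5 * c))).
have c5 : 0 < 5 * c by rewrite mulr_gt0.
have m0 : 0 < m by rewrite !lt_min d0 subr_gt0 tl !divr_gt0.
have [r /andP[r0 rm] hr] := small_sqrt K'0 e2 m0.
move: rm; rewrite !le_min => /andP[/andP[rd rl] /andP[r1 r2]].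
pose s := t + r.
have st : s - t = r by rewrite /s addrAC subrr add0r.
have ts : t < s by rewrite ltrDl.
have sl : s <= l by rewrite /s; lra.
have h5 : 5 * c * (s - t) <= 1 by rewrite st mulrC -ler_pdivlMr.
have h1 := minimal_speed mX t0 ts sl h5.
have nst : `|s - t| = r by rewrite st gtr0_norm.
have h2 : `|quot X t s - D t| <= K * Num.sqrt r.
  rewrite -nst; apply: hD; rewrite ?nst ?gt_eqF //; apply/andP; split => //; lra.
have h3 : nrm (invmx (X t) *m (D t - quot X t s)) <= e / 2.
  apply: le_trans (hr r (ltW r0) (lexx _)).
  rewrite -!mulrA; apply: (le_trans (nrm_mulmx g _ _)); apply: ler_wpM2l => //.
  apply: ler_pM; rewrite ?nrm_ge0 //; first by case: (hb t t0 (ltW tl)).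
  apply: (le_trans (nrm_le_norm g _)); apply: ler_wpM2l => //.
  by rewrite distrC.
have h4 : 5 * c * (s - t) <= e / 2 by rewrite st mulrC -ler_pdivlMr.
have := nrm_dist (invmx (X t) *m D t) (invmx (X t) *m quot X t s).
rewrite -mulmxBr => h6.
have := ler_normD (nrm (invmx (X t) *m D t) - nrm (invmx (X t) *m quot X t s))
  (nrm (invmx (X t) *m quot X t s) - 1).
rewrite addrA subrK; lra.
Qed.

(** At [t = l] no chord starts, so a chord ending there is used: its speed in the frame of its left
    end is at least 1/2, while [D t = 0] would make it at most 1/4. The latter dictates [k]. *)
Lemma minimal_derivative_neq0 t : 0 <= t <= l -> D t != 0.
Proof.
move=> /andP[t0 tl]; move: (tl); rewrite le_eqVlt => /orP[/eqP tl'|tl']; last first.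
  apply/negP => /eqP h; have := minimal_unit_speed t0 tl'.
  by rewrite h mulmx0 nrm0 => /esym/eqP; rewrite oner_eq0.
have t1 : 0 < t by rewrite tl'.
have [b b1 hb] := minimal_bounded l0 mX.
have b0 : 0 < b by lra.
pose k := 1 / (4 * (c * (b * c))).
have k0 : 0 < k by rewrite divr_gt0 // !mulr_gt0.
pose m := Num.min (Num.min d t) (1 / 2 / (5 * c)).
have c5 : 0 < 5 * c by rewrite mulr_gt0.
have m0 : 0 < m by rewrite !lt_min d0 t1 !divr_gt0.
have [r /andP[r0 rm] hr] := small_sqrt K0 k0 m0.
move: rm; rewrite !le_min => /andP[/andP[rd rt] r1].
pose s := t - r.
have st : t - s = r by rewrite /s subKr.
have s0 : 0 <= s by rewrite subr_ge0.
have ts : s < t by rewrite /s; lra.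
have h5 : 5 * c * (t - s) <= 1 / 2 by rewrite st mulrC -ler_pdivlMr.
have h51 : 5 * c * (t - s) <= 1 by lra.
have h1 := minimal_speed mX s0 ts tl h51.
have nst : `|s - t| = r by rewrite distrC st gtr0_norm.
have h2 : `|quot X t s - D t| <= K * Num.sqrt r.
  rewrite -nst; apply: hD; rewrite ?nst ?lt_eqF //; apply/andP; split => //; lra.
have h3 := hr r (ltW r0) (lexx _).
apply/negP => /eqP D0; rewrite D0 subr0 quotC in h2.
have : nrm (invmx (X s) *m quot X s t) <= c * (b * (c * k)).
  apply: (le_trans (nrm_mulmx g _ _)); apply: ler_wpM2l => //.
  apply: ler_pM; rewrite ?nrm_ge0 //; first by case: (hb s s0 (ltW (lt_le_trans ts tl))).
  apply: (le_trans (nrm_le_norm g _)); apply: ler_wpM2l => //; lra.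
have -> : c * (b * (c * k)) = 1 / 4.
  by rewrite /k; field; rewrite !gt_eqF.
move: h1; rewrite ler_norml => /andP[h1 _]; lra.
Qed.

End with_derivative.

Lemma minimal_regular : {within `[0, l], continuous X} /\ exists D : R -> 'M[R]_n,
  [/\ forall t, t \in `[0, l] ->
        (s - t)^-1 *: (X s - X t) @[s --> within `[0, l] t^'] --> D t,
      {within `[0, l], continuous D},
      forall t, t \in `[0, l] -> D t != 0 &
      forall t, 0 <= t -> t < l -> nrm (invmx (X t) *m D t) = 1].
Proof.
have [D [K [d [K0 d0 hD]]]] := minimal_derivative l0 mX.
split; first exact: (minimal_continuous K0 d0 hD).
exists D; split.
- by move=> t; rewrite in_itv /=; exact: (minimal_cvg_quot K0 d0 hD).
- exact: (minimal_derivative_continuous K0 d0 hD).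
- by move=> t; rewrite in_itv /=; exact: (minimal_derivative_neq0 K0 d0 hD).
- by move=> t; exact: (minimal_unit_speed K0 d0 hD).
Qed.

Lemma minimal_admissible : admissible (X 0) (X l) 0 l X.
Proof.
have [cX [D [D1 D2 D3 D4]]] := minimal_regular.
split => //.
  move=> t; rewrite in_itv /= => /andP[t0 tl]; rewrite /GL /= -unitfE -unitmxE.
  exact: (minimal_unit mX t0 tl).
exists [:: l]; first by split => //=; rewrite l0.
by case=> [|[]] //= _; exists D.
Qed.

(** [derive1] is identified with [D] on the open interval only, where the integrand is 1; the
    endpoints are null sets. *)
Lemma minimal_length :
  (\int[lebesgue_measure]_(t in `[0%R, l]) (nrm (invmx (X t) *m derive1 X t))%:E = l%:E)%E.
Proof.
have [cX [D [D1 D2 D3 D4]]] := minimal_regular.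
have f1 t : t \in `]0, l[ -> nrm (invmx (X t) *m derive1 X t) = 1.
  rewrite in_itv /= => /andP[t0 tl].
  rewrite (@derive1_within _ _ 0 l t X (D t)) ?t0 //; first by apply: D4; rewrite // ltW.
  by apply: D1; rewrite in_itv /= !ltW.
rewrite (integral_itv_bndoo (x := 0) (y := l)).
  rewrite (eq_integral (cst 1%E)).
    rewrite integral_cst //= lebesgue_measure_itv /= lte_fin l0 sube0 mul1e //.
  by move=> t; rewrite inE => /f1 ->.
apply/measurable_EFinP.
have m1 : measurable_fun (`]0, l[%classic : set (measurableTypeR R))
    (cst 1 : measurableTypeR R -> measurableTypeR R) by exact: measurable_cst.
refine (eq_measurable_fun _ _ m1).
by move=> t; rewrite inE => /f1 ->.
Qed.

End minimal_is_admissible.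

(** * Lengths of admissible curves *)

Section interval_integral.
Variable R : realType.
Local Notation mu := (@lebesgue_measure R).

Lemma segment_integrable (a b : R) (G : R -> R) : {within `[a, b], continuous G} ->
  mu.-integrable `[a, b] (EFin \o G).
Proof. by move=> cG; apply: continuous_compact_integrable => //; exact: segment_compact. Qed.

Lemma segment_integrableS (a b s t : R) (G : R -> R) : a <= s -> t <= b ->
  mu.-integrable `[a, b] (EFin \o G) -> mu.-integrable `[s, t] (EFin \o G).
Proof.
move=> as_ tb; apply: integrableS => // x; rewrite /= !in_itv /= => /andP[sx xt].
by rewrite (le_trans as_) // (le_trans xt).
Qed.

Lemma Rintegral_itv_cat (a b s t u : R) (G : R -> R) :
  mu.-integrable `[a, b] (EFin \o G) -> a <= s -> s <= t -> t <= u -> u <= b ->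
  (\int[mu]_(x in `[s, t]) G x + \int[mu]_(x in `[t, u]) G x = \int[mu]_(x in `[s, u]) G x)%R.
Proof.
move=> iG as_ st tu ub_.
have iS : mu.-integrable `[s, u] (EFin \o G) by exact: segment_integrableS iG.
have iT : mu.-integrable `]t, u] (EFin \o G).
  by apply: integrableS iS => // x; rewrite /= !in_itv /= => /andP[tx ->]; rewrite (le_trans st) // ltW.
have := @Rintegral_itvB R G (BLeft s) (BRight u) t iS; rewrite !bnd_simp => /(_ st tu).
rewrite (Rintegral_itv_obnd_cbnd iT) => <-; ring.
Qed.

Lemma Rintegral_itv_ge (a b s t m : R) (G : R -> R) :
  mu.-integrable `[a, b] (EFin \o G) -> a <= s -> s <= t -> t <= b ->
  (forall x, s <= x <= t -> m <= G x) -> m * (t - s) <= (\int[mu]_(x in `[s, t]) G x)%R.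
Proof.
move=> iG as_ st tb mG.
have -> : m * (t - s) = (\int[mu]_(x in `[s, t]) m)%R.
  rewrite Rintegral_cst //= lebesgue_measure_itv /= lte_fin.
  by case: ltgtP st => //= -> _; rewrite subrr.
apply: le_Rintegral => //.
- by apply: segment_integrable; apply: continuous_subspaceT => x; exact: cvg_cst.
- exact: segment_integrableS iG.
Qed.

End interval_integral.

Section admissible_reach.
Variables (R : realType) (n : nat) (g : inner_norm R n).
Local Notation c := (icst g).
Local Notation nrm := (nrm g).
Local Notation step := (step g).
Local Notation mu := (@lebesgue_measure R).
Let c0 : 0 < c := icst_gt0 g.
Let c0' : 0 <= c := icst_ge0 g.

(** A derivative at [t] controls steps leaving [Y t], whereas a chain also needs steps arriving
    there. The factor 2 of [step_sym] would spoil the comparison with the integral; here the ratio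
    tends to 1 with the step. *)
Lemma step_sym_sharp (x y : 'M[R]_n) : x \in unitmx -> y \in unitmx -> c * step x y <= 1 / 2 ->
  step y x <= (1 + 2 * c * step x y) * step x y.
Proof.
move=> ux uy h; have h2 := step_sym ux uy h.
have sE : step y x = nrm ((1%:M + (invmx y *m x - 1%:M)) *m (invmx x *m y - 1%:M)).
  rewrite [1%:M + _]addrC subrK mulmxBr mulmx1 mulmxA mulmxK // mulVmx //.
  by rewrite -[in RHS]nrmN opprB.
rewrite sE; apply: (le_trans (nrm_mul1D g _ _)).
apply: ler_wpM2r; first exact: nrm_ge0.
have -> : nrm (invmx y *m x - 1%:M) = step y x by [].
have := ler_wpM2l c0' h2; lra.
Qed.

(** Steps with one end at [t] are compared with the integral of the continuous speed [G]. As [D t]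
    is nonzero, [G t > 0], and errors taken relative to [G t] add up to a factor [1 + th] on the
    integral. *)
Lemma regular_piece (a b : R) (Y D : R -> 'M[R]_n) : a < b ->
  (forall t, t \in `[a, b] -> Y t \in unitmx) ->
  {within `[a, b], continuous Y} ->
  (forall t, t \in `[a, b] ->
     (s - t)^-1 *: (Y s - Y t) @[s --> within `[a, b] t^'] --> D t) ->
  {within `[a, b], continuous D} -> (forall t, t \in `[a, b] -> D t != 0) ->
  let f := fun t => nrm (invmx (Y t) *m derive1 Y t) in
  measurable_fun `[a, b] (fun t => (f t)%:E) /\
  exists2 L : R, (\int[mu]_(t in `[a, b]) (f t)%:E = L%:E)%E & reach g L (Y a) (Y b).
Proof.
move=> ab uY cY dY cD D0 f.
pose G t := nrm (invmx (Y t) *m D t).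
have ab_ (P : R -> Prop) : (forall t, t \in `[a, b] -> P t) -> forall t, a <= t <= b -> P t.
  by move=> h t tab; apply: h; rewrite in_itv.
have cG : {within `[a, b], continuous G}.
  apply/subspace_continuousP => t tab.
  have /subspace_continuousP/(_ t tab) cYt := cY.
  have /subspace_continuousP/(_ t tab) cDt := cD.
  apply: cvg_nrm; apply: cvg_mulmx => //; apply: cvg_invmx => //; exact: uY.
have fG t : t \in `]a, b[ -> f t = G t.
  rewrite in_itv /= => tab; rewrite /f (derive1_within tab (dY t _)) //.
  by move: tab => /andP[h1 h2]; rewrite in_itv /= !ltW.
have iG := segment_integrable cG.
have mG : measurable_fun `[a, b] (EFin \o G) by case/integrableP: iG.
have moG : measurable_fun `]a, b[ (EFin \o G).
  apply: measurable_funS mG => //; exact: subset_itv_oo_cc.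
have mof : measurable_fun `]a, b[ (fun t => (f t)%:E).
  refine (eq_measurable_fun _ _ moG).
  by move=> t; rewrite inE /= => tab; rewrite /= fG.
split; first exact: emeasurable_fun_itv_cc mof.
exists (\int[mu]_(x in `[a, b]) G x)%R.
  rewrite (integral_itv_bndoo (x := a) (y := b) true false mof).
  rewrite /Rintegral fineK; last by apply: integrable_fin_num => //; exact: iG.
  rewrite (integral_itv_bndoo (x := a) (y := b) true false moG).
  by apply: eq_integral => t; rewrite inE /= => tab; rewrite fG.
move=> e e0.
pose I s t := (\int[mu]_(x in `[s, t]) G x)%R.
have I0 : 0 <= I a b by apply: Rintegral_ge0 => t _; exact: nrm_ge0.
(* This gives [th * I a b <= e]; the 1 avoids a division by zero. *)
pose th := e / (1 + I a b).
have th0 : 0 < th by rewrite divr_gt0 // ltr_pwDl.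
have [|s t u as_ st tu ub_|t tab|L hL cL] :=
  @chain_curve _ _ g Y a b e (fun s t => (1 + th) * I s t) (ltW ab).
- exact: ab_.
- by rewrite -mulrDr /I (@Rintegral_itv_cat _ a b).
- have tab' : t \in `[a, b] by rewrite in_itv.
  have ut := uY t tab'.
  have G0 : 0 < G t.
    rewrite lt_def nrm_ge0 andbT; apply/negP => /eqP/nrm_eq0 h.
    have := D0 t tab'; rewrite -[D t](mulKVmx ut) h mulmx0 eqxx //.
  (* Small enough for [(1 + k) ^ 2 <= (1 + th) * (1 - k)]: one factor [1 + k] comes from the
     derivative, the other from reversing a step, and [1 - k] from the lower bound on [G]. *)
  pose k := Num.min th 1 / 8.
  have k0 : 0 < k by rewrite divr_gt0 // lt_min th0 ltr01.
  have k1 : 8 * k <= 1 by rewrite /k mulrC divfK // ge_min lexx orbT.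
  have kth : 8 * k <= th by rewrite /k mulrC divfK // ge_min lexx.
  have kG : 0 < k * G t by rewrite mulr_gt0.
  have cGt : G s @[s --> within `[a, b] (nbhs t)] --> G t.
    by have /subspace_continuousP := cG; apply.
  move/cvgrPdistC_le : cGt => /(_ _ kG) /within_nbhs_near[r1 r10 h1].
  have cQ : nrm (invmx (Y t) *m ((s - t)^-1 *: (Y s - Y t))) @[s --> within `[a, b] t^'] --> G t.
    by apply: cvg_nrm; apply: cvg_mulmx; [exact: cvg_cst|exact: dY].
  move/cvgrPdistC_le : cQ => /(_ _ kG) /within_dnbhs_near[r2 r20 h2].
  (* Steps up to [k / (2 * c)] reverse with a factor at most [1 + k]; steps up to [e / 2] remain at
     most [e] after reversal. *)
  pose w := Num.min (k / (2 * c)) (e / 2).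
  have c2 : 0 < 2 * c by rewrite mulr_gt0.
  have w0 : 0 < w by rewrite lt_min (divr_gt0 k0 c2) divr_gt0.
  pose d := Num.min (Num.min r1 r2) (w / (2 * G t)).
  have G2 : 0 < 2 * G t by rewrite mulr_gt0.
  have d0 : 0 < d by rewrite !lt_min r10 r20 (divr_gt0 w0 G2).
  have fwd s : a <= s <= b -> `|s - t| < d ->
      step (Y t) (Y s) <= (1 + k) * G t * `|s - t| /\ step (Y t) (Y s) <= w.
    move=> sab; rewrite !lt_min => /andP[/andP[s1 s2] s3].
    have [->|st] := eqVneq s t.
      by rewrite subrr normr0 mulr0 stepxx //; split => //; exact: ltW.
    have := h2 s; rewrite /= in_itv /= => /(_ sab st s2).
    rewrite -scalemxAr nrmZ ler_norml => /andP[_ h].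
    have st0 : 0 < `|s - t| by rewrite normr_gt0 subr_eq0.
    have e1 : nrm (invmx (Y t) *m (Y s - Y t)) = step (Y t) (Y s).
      by rewrite /step mulmxBr mulVmx.
    have h3 : step (Y t) (Y s) <= (1 + k) * G t * `|s - t|.
      move: h; rewrite lerBlDr e1 normfV mulrC ler_pdivrMr //; lra.
    split => //; apply: (le_trans h3).
    move: s3; rewrite ltr_pdivlMr ?mulr_gt0 // => s3.
    have : (1 + k) * (G t * `|s - t|) <= 2 * (G t * `|s - t|).
      by apply: ler_wpM2r; [rewrite mulr_ge0 // ltW|lra].
    lra.
  have Ilow s s' : a <= s -> s <= s' -> s' <= b -> (s = t \/ s' = t) -> `|s - t| < d -> `|s' - t| < d ->
      (1 - k) * G t * (s' - s) <= I s s'.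
    move=> as_ ss' s'b stt; rewrite !lt_min => /andP[/andP[s1 _] _] /andP[/andP[s1' _] _].
    apply: (@Rintegral_itv_ge _ a b) => // x /andP[sx xs'].
    have := h1 x; rewrite /= in_itv /= (le_trans as_ sx) (le_trans xs' s'b) => /(_ isT).
    have xt : `|x - t| < r1.
      move: s1 s1'; rewrite !ltr_norml => /andP[? ?] /andP[? ?]; apply/andP; split; lra.
    move=> /(_ xt); rewrite ler_norml => /andP[h _]; lra.
  have fin q x : 0 <= q -> (1 - k) * G t * q <= x -> (1 + k) * ((1 + k) * G t * q) <= (1 + th) * x.
    move=> q0 h.
    have h' : (1 + th) * ((1 - k) * G t * q) <= (1 + th) * x.
      by rewrite ler_wpM2l // addr_ge0 // ltW.
    apply: le_trans h'.
    have Gq : 0 <= G t * q by rewrite mulr_ge0 // ltW.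
    have kk : k * k <= k * (1 / 8) by apply: ler_wpM2l; [exact: ltW|lra].
    have kt : k * th <= (1 / 8) * th by apply: ler_wpM2r; [exact: ltW|lra].
    have : (1 + k) * (1 + k) * (G t * q) <= (1 + th) * (1 - k) * (G t * q).
      by apply: ler_wpM2r => //; lra.
    lra.
  exists d => // s sab sd; have [f1 f2] := fwd s sab sd.
  have sab' : s \in `[a, b] by rewrite in_itv.
  move: (f2); rewrite le_min => /andP[f3 f4].
  have cw : 2 * c * step (Y t) (Y s) <= k.
    by rewrite mulrC -ler_pdivlMr // mulr_gt0.
  have tt : `|t - t| < d by rewrite subrr normr0.
  have [[as_ sb] [at_ tb]] := (andP sab, andP tab).
  have sr0 := step_ge0 g (Y t) (Y s).
  split => st.
    have h3 := step_sym_sharp ut (uY s sab') _.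
    have h4 : step (Y s) (Y t) <= (1 + k) * step (Y t) (Y s).
      apply: (le_trans (h3 _)); first by lra.
      by apply: ler_wpM2r => //; rewrite lerD2l.
    rewrite le_min; apply/andP; split.
      apply: (le_trans h4); have : (1 + k) * step (Y t) (Y s) <= 2 * step (Y t) (Y s).
        by apply: ler_wpM2r => //; lra.
      lra.
    have nst : `|s - t| = t - s by rewrite distrC ger0_norm // subr_ge0.
    apply: (le_trans h4); apply: (@le_trans _ _ ((1 + k) * ((1 + k) * G t * (t - s)))).
      by apply: ler_wpM2l; [rewrite addr_ge0 // ltW|rewrite -nst].
    apply: fin; first by rewrite subr_ge0.
    by apply: Ilow => //; right.
  have nst : `|s - t| = s - t by rewrite ger0_norm // subr_ge0.
  rewrite le_min; apply/andP; split; first by lra.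
  apply: (@le_trans _ _ ((1 + k) * ((1 + k) * G t * (s - t)))).
    rewrite -nst; apply: (le_trans f1); rewrite ler_peMl //; last by lra.
    apply: mulr_ge0 => //; apply: mulr_ge0; last exact: ltW.
    by rewrite addr_ge0 // ltW.
  apply: fin; first by rewrite subr_ge0.
  by apply: Ilow => //; left.
exists L => //; apply: (le_trans hL); rewrite mulrDl mul1r lerD2l /th.
by rewrite mulrAC ler_pdivrMr ?ltr_pwDl // ler_wpM2l ?ltW // ltrDr.
Qed.

End admissible_reach.

Section admissible_curves.
Variables (R : realType) (n : nat) (g : inner_norm R n).
Local Notation nrm := (nrm g).
Local Notation mu := (@lebesgue_measure R).

Lemma integral_itv_cat (f : R -> \bar R) (a b x : R) : a <= x -> x <= b ->
  (forall t, (0 <= f t)%E) ->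
  measurable_fun `[a, x] f -> measurable_fun `[x, b] f ->
  measurable_fun `[a, b] f /\
  (\int[mu]_(t in `[a, b]) f t = \int[mu]_(t in `[a, x]) f t + \int[mu]_(t in `[x, b]) f t)%E.
Proof.
move=> ax xb f0 m1 m2.
have mo : measurable_fun `]x, b] f.
  by apply: measurable_funS m2 => // t; rewrite /= !in_itv /= => /andP[/ltW-> ->].
have U : `[a, b]%classic = `[a, x] `|` `]x, b] :> set R.
  by apply: itv_bndbnd_setU; rewrite !bnd_simp.
have mU : measurable_fun (`[a, x] `|` `]x, b]) f by apply/measurable_funU.
split; first by rewrite U.
rewrite -(integral_itv_obnd_cbnd mo) U ge0_integral_setU //.
apply/disj_setPS => t [/=]; rewrite !in_itv /= => /andP[_ tx] /andP[xt _].
by have := le_lt_trans tx xt; rewrite ltxx.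
Qed.

Definition speed (Y : R -> 'M[R]_n) (t : R) : R := nrm (invmx (Y t) *m derive1 Y t).

(** Measurability is carried through the induction on the break points because gluing the integrals
    requires it on both pieces. *)
Lemma partition_reach (Y : R -> 'M[R]_n) (s : seq R) (a b : R) : itv_partition a b s ->
  (forall t, t \in `[a, b] -> Y t \in unitmx) ->
  {within `[a, b], continuous Y} ->
  (forall j : nat, (j < size s)%N ->
    regular_C1 (nth b (a :: s) j) (nth b (a :: s) j.+1) Y) ->
  measurable_fun `[a, b] (fun t => (speed Y t)%:E) /\
  exists2 L : R, (\int[mu]_(t in `[a, b]) (speed Y t)%:E = L%:E)%E & reach g L (Y a) (Y b).
Proof.
elim: s a => [|x s IH] a hs uY cY rY.
  rewrite -(itv_partition_nil hs) set_itv1; split; first exact: measurable_fun_set1.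
  have ua : Y a \in unitmx by apply: uY; rewrite in_itv /= lexx (itv_partition_le hs).
  exists 0; first by rewrite integral_set1.
  by move=> e e0; exists 0; [rewrite add0r ltW|exact: chain_nil].
have hs' := itv_partition_cons hs.
have xb := itv_partition_le hs'.
have ax : a < x by case: hs => /= /andP[].
have sub1 : (`[a, x]%classic : set R) `<=` `[a, b].
  by move=> t; rewrite /= !in_itv /= => /andP[-> tx]; exact: le_trans xb.
have sub2 : (`[x, b]%classic : set R) `<=` `[a, b].
  by move=> t; rewrite /= !in_itv /= => /andP[xt ->]; rewrite andbT; exact: le_trans (ltW ax) xt.
have [D [D1 D2 D3]] := rY 0%N isT.
have [m1 [L1 i1 r1]] := regular_piece g ax (fun t h => uY t (sub1 t h))
  (continuous_subspaceW sub1 cY) D1 D2 D3.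
have [|m2 [L2 i2 r2]] := IH x hs' (fun t h => uY t (sub2 t h)) (continuous_subspaceW sub2 cY).
  by move=> j; exact: (rY j.+1).
have f0 t : (0 <= (speed Y t)%:E)%E by rewrite lee_fin nrm_ge0.
have [m i] := integral_itv_cat (ltW ax) xb f0 m1 m2.
split=> //; exists (L1 + L2); last exact: reach_trans r2.
by rewrite i i1 i2.
Qed.

Lemma GL_unitmx (M : 'M[R]_n) : GL M -> M \in unitmx.
Proof. by rewrite /GL /= unitmxE unitfE. Qed.

Lemma admissible_reach A B a b (Y : R -> 'M[R]_n) : admissible A B a b Y ->
  exists2 L : R, (\int[mu]_(t in `[a, b]) (speed Y t)%:E = L%:E)%E & reach g L A B.
Proof.
move=> [ab [<- <-] uY cY [s hs rY]].
have [_ //] := partition_reach hs (fun t h => GL_unitmx (uY t h)) cY rY.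
Qed.

Lemma regular_length_le (a b m : R) (Y D : R -> 'M[R]_n) : a < b ->
  (forall t, t \in `[a, b] -> Y t \in unitmx) ->
  {within `[a, b], continuous Y} ->
  (forall t, t \in `[a, b] ->
     (s - t)^-1 *: (Y s - Y t) @[s --> within `[a, b] t^'] --> D t) ->
  {within `[a, b], continuous D} -> (forall t, t \in `[a, b] -> D t != 0) ->
  (forall t, a < t < b -> nrm (invmx (Y t) *m D t) <= m) ->
  measurable_fun `[a, b] (fun t => (speed Y t)%:E) /\
  (\int[mu]_(t in `[a, b]) (speed Y t)%:E <= (m * (b - a))%:E)%E.
Proof.
move=> ab uY cY D1 D2 D3 hm.
have [mf _] := regular_piece g ab uY cY D1 D2 D3; split => //.
have mof : measurable_fun `]a, b[ (fun t => (speed Y t)%:E).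
  by apply: measurable_funS mf => //; exact: subset_itv_oo_cc.
rewrite (integral_itv_bndoo (x := a) (y := b) true false mof).
apply: (@le_trans _ _ (\int[mu]_(t in `]a, b[) (cst m%:E t))%E); last first.
  by rewrite integral_cst //= lebesgue_measure_itv /= lte_fin ab EFinM.
apply: ge0_le_integral => //.
- by move=> t _; rewrite lee_fin nrm_ge0.
- move=> t; rewrite /= in_itv /= => tab; rewrite lee_fin.
  rewrite /speed (derive1_within tab (D1 t _)) ?hm //.
  by case/andP: tab => h1 h2; rewrite in_itv /= !ltW.
Qed.

End admissible_curves.

(** * Connectedness of GL+ *)

Section connectedness.
Variables (R : realType) (n : nat) (g : inner_norm R n).
Implicit Types x y : 'M[R]_n.
Local Notation c := (icst g).
Local Notation step := (step g).
Let c0 : 0 < c := icst_gt0 g.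
Let c0' : 0 <= c := icst_ge0 g.

Lemma step_translate (P x y : 'M[R]_n) : P \in unitmx -> x \in unitmx ->
  step (P *m x) (P *m y) = step x y.
Proof.
move=> uP ux; have uPx : P *m x \in unitmx by rewrite unitmx_mul uP.
congr (nrm _ (_ - _)); apply: (can_inj (mulKmx uPx)).
by rewrite mulKVmx // -mulmxA mulKVmx.
Qed.

Lemma chain_translate (P : 'M[R]_n) e L x y : P \in unitmx -> chain g e L x y ->
  chain g e L (P *m x) (P *m y).
Proof.
move=> uP; elim=> {x y L} [x ux|x y z L ux xy _ IH].
  by apply: chain_nil; rewrite unitmx_mul uP.
rewrite -(step_translate y uP ux); apply: chain_cons => //.
  by rewrite unitmx_mul uP.
by rewrite step_translate.
Qed.

Lemma reach_translate (P : 'M[R]_n) L x y : P \in unitmx -> reach g L x y ->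
  reach g L (P *m x) (P *m y).
Proof.
by move=> uP h e /h[L' hL cL]; exists L' => //; exact: chain_translate.
Qed.

(** Near [t] the steps from [X t] are at most [1 / (4 c)], so straight segments join the points in
    both directions at finite cost, and Cousin's lemma concatenates them. *)
Lemma path_reach (X : R -> 'M[R]_n) : continuous X ->
  (forall t, 0 <= t <= 1 -> X t \in unitmx) -> exists L : R, reach g L (X 0) (X 1).
Proof.
move=> cX uX; apply: (@cousin R (fun s t => exists L : R, reach g L (X s) (X t)) 0 1 ler01).
  by move=> s t u _ _ _ _ [L1 r1] [L2 r2]; exists (L1 + L2); exact: reach_trans r2.
move=> t ht; have ut := uX t ht.
have st : step (X t) (X s) @[s --> t] --> (0 : R).
  rewrite -(stepxx g ut); apply: cvg_nrm; apply: cvgB; last exact: cvg_cst.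
  by apply: cvg_mulmx; [exact: cvg_cst|exact: cX].
have k0 : 0 < 1 / 4 / c by rewrite !divr_gt0.
move/cvgrPdistC_le : st => /(_ _ k0) /nbhs_ballP[d /= d0 hd].
exists d => // s hs sd; have us := uX s hs.
have h : c * step (X t) (X s) <= 1 / 4.
  have := hd s; rewrite /ball /= distrC => /(_ sd).
  by rewrite subr0 ger0_norm ?step_ge0 // ler_pdivlMr //; lra.
have h2 : c * step (X t) (X s) <= 1 / 2 by lra.
have h3 : c * step (X s) (X t) <= 1 / 2.
  by have := ler_wpM2l c0' (step_sym ut us h2); lra.
split=> _.
  by have [_ ?] := segment_reach us h3; exists (step (X s) (X t) / (1 - c * step (X s) (X t))).
by have [_ ?] := segment_reach ut h2; exists (step (X t) (X s) / (1 - c * step (X t) (X s))).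
Qed.

Lemma line_reach x y : (forall s : R, 0 <= s <= 1 -> x + s *: (y - x) \in unitmx) ->
  exists L : R, reach g L x y.
Proof.
move=> h; have := @path_reach (fun s => x + s *: (y - x)); rewrite scale0r scale1r addr0 [x + (y - x)]addrC subrK.
apply=> // s; apply: cvgD; first exact: cvg_cst.
by apply: cvgZl.
Qed.

(** The sign of the determinant is kept along, since it finally decides between [x] and its product
    with a reflection. *)
Definition conn x := 0 < \det x /\ exists L : R, reach g L 1%:M x.

Lemma conn_mul x y : conn x -> conn y -> conn (x *m y).
Proof.
move=> [dx [Lx rx]] [dy [Ly ry]]; split; first by rewrite det_mulmx mulr_gt0.
have ux : x \in unitmx by rewrite unitmxE unitfE gt_eqF.
exists (Lx + Ly); apply: (reach_trans rx); have := reach_translate ux ry.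
by rewrite mulmx1.
Qed.

Lemma conn1 : conn 1%:M.
Proof.
split; first by rewrite det1.
by exists 0 => e e0; exists 0; [rewrite add0r ltW|apply: chain_nil; exact: unitmx1].
Qed.

(** Triangular matrices with unit diagonal, positive diagonal matrices and transvections are all
    joined to 1 in this way. *)
Lemma conn_line x : (forall s : R, 0 <= s <= 1 -> 0 < \det (1%:M + s *: (x - 1%:M))) -> conn x.
Proof.
move=> h; split; first by have := h 1; rewrite scale1r addrC subrK; apply; rewrite ler01 lexx.
by apply: line_reach => s /h; rewrite unitmxE unitfE => /lt0r_neq0.
Qed.

Lemma conn_lower x : (forall i j : 'I_n, (i <= j)%N -> x i j = (i == j)%:R) -> conn x.
Proof.
move=> h; apply: conn_line => s _.
have hs (i j : 'I_n) : (i <= j)%N -> (1%:M + s *: (x - 1%:M)) i j = (i == j)%:R.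
  by move=> ij; rewrite !mxE h // subrr mulr0 addr0.
rewrite det_trig.
  by rewrite big1 ?ltr01 // => i _; rewrite hs // eqxx.
apply/is_trig_mxP => i j ij; rewrite hs; last exact: ltnW.
by rewrite -val_eqE /= ltn_eqF.
Qed.

Lemma conn_upper x : (forall i j : 'I_n, (j <= i)%N -> x i j = (i == j)%:R) -> conn x.
Proof.
move=> h; apply: conn_line => s _.
have hs (i j : 'I_n) : (j <= i)%N -> (1%:M + s *: (x - 1%:M)) i j = (i == j)%:R.
  by move=> ij; rewrite !mxE h // subrr mulr0 addr0.
rewrite -det_tr det_trig.
  by rewrite big1 ?ltr01 // => i _; rewrite mxE hs // eqxx.
apply/is_trig_mxP => i j ij; rewrite mxE hs; last exact: ltnW.
by rewrite -val_eqE /= gtn_eqF.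
Qed.

Lemma conn_diag (d : 'rV[R]_n) : (forall i, 0 < d 0 i) -> conn (diag_mx d).
Proof.
move=> h; apply: conn_line => s /andP[s0 s1].
have -> : 1%:M + s *: (diag_mx d - 1%:M) = diag_mx (\row_i (1 + s * (d 0 i - 1))).
  apply/matrixP => i j; rewrite !mxE; case: (i == j); rewrite ?mulr1n ?mulr0n //.
  by rewrite subrr mulr0 addr0.
rewrite det_diag; apply: prodr_gt0 => i _; rewrite mxE; have := h i.
have [->|s01] := eqVneq s 1; first by lra.
have : s < 1 by rewrite lt_def eq_sym s01.
nra.
Qed.

Lemma conn_transvection (i j : 'I_n) (a : R) : i != j -> conn (1%:M + a *: delta_mx i j).
Proof.
move=> ij; have sq b : (1%:M + b *: delta_mx i j) *m (1%:M + b *: delta_mx i j) =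
    1%:M + (2 * b) *: delta_mx i j :> 'M[R]_n.
  rewrite mulmxDl !mulmxDr !mulmx1 mul1mx -scalemxAl -scalemxAr mul_delta_mx_cond.
  by rewrite eq_sym (negbTE ij) mulr0n !scaler0 addr0 -addrA -scalerDl mulr_natl mulr2n.
have iv b : (1%:M + b *: delta_mx i j) *m (1%:M + (- b) *: delta_mx i j) = 1%:M :> 'M[R]_n.
  rewrite mulmxDl !mulmxDr !mulmx1 mul1mx -scalemxAl -scalemxAr mul_delta_mx_cond.
  by rewrite eq_sym (negbTE ij) mulr0n !scaler0 addr0 -addrA -scalerDl addNr scale0r addr0.
have pos b : 0 < \det (1%:M + b *: delta_mx i j : 'M[R]_n).
  (* a unit that is a square has positive determinant *)
  have -> : b = 2 * (b / 2) by field.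
  rewrite -sq det_mulmx -expr2 exprn_even_gt0 //=.
  by have [] := mulmx1_unit (iv (b / 2)); rewrite unitmxE unitfE.
by apply: conn_line => s _; rewrite [1%:M + a *: _]addrC addrK scalerA.
Qed.

End connectedness.

(** * Reflections, permutations and the factors of the LU decomposition *)

Section GLplus_connected.
Variables (R : realType) (n : nat) (g : inner_norm R n.+1).
Implicit Types x y : 'M[R]_n.+1.
Local Notation conn := (conn g).
Local Notation dl i j := (delta_mx i j : 'M[R]_n.+1).

Definition flip (i : 'I_n.+1) : 'M[R]_n.+1 := 1%:M - 2 *: dl i i.
(** For [i != j], the quarter turn in the plane of the coordinates [i] and [j]. *)
Definition rot (i j : 'I_n.+1) : 'M[R]_n.+1 := 1%:M - dl i i - dl j j - dl i j + dl j i.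

Lemma flipK i : flip i *m flip i = 1%:M.
Proof.
rewrite /flip mulmxBl !mulmxBr !mulmx1 mul1mx -scalemxAl -scalemxAr mul_delta_mx scalerA.
by apply/matrixP => a b; rewrite !mxE; ring.
Qed.

(** A quarter turn is a product of three shears. *)
Lemma conn_rot i j : i != j -> conn (rot i j).
Proof.
move=> ij.
have -> : rot i j = (1%:M + (-1) *: dl i j) *m (1%:M + 1 *: dl j i) *m (1%:M + (-1) *: dl i j).
  have h1 : dl i j *m dl j i = dl i i by exact: mul_delta_mx.
  have h2 : dl j i *m dl i j = dl j j by exact: mul_delta_mx.
  have h3 : dl i j *m dl i j = 0 by apply: mul_delta_mx_0; rewrite eq_sym.
  have h4 : dl i i *m dl i j = dl i j by exact: mul_delta_mx.
  rewrite scaleN1r scale1r !(mulmxDl, mulmxDr, mulNmx, mulmxN, mulmx1, mul1mx, h1, h2, h3, h4).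
  by apply/matrixP => a b; rewrite !mxE; ring.
by apply: conn_mul; [apply: conn_mul|]; apply: conn_transvection; rewrite // eq_sym.
Qed.


(** Splits a transposition, of determinant -1, into a reflection and a factor connected to 1. *)
Lemma flip_rot i j : i != j -> flip i *m rot i j = tperm_mx i j.
Proof.
move=> ij.
have h1 : dl i i *m dl i i = dl i i by exact: mul_delta_mx.
have h2 : dl i i *m dl j j = 0 by exact: mul_delta_mx_0.
have h3 : dl i i *m dl i j = dl i j by exact: mul_delta_mx.
have h4 : dl i i *m dl j i = 0 by exact: mul_delta_mx_0.
have -> : flip i *m rot i j = 1%:M - dl i i - dl j j + dl i j + dl j i.
  rewrite /flip mulmxBl mul1mx -scalemxAl /rot.
  rewrite !(mulmxDr, mulmxN, mulmx1, h1, h2, h3, h4).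
  by apply/matrixP => a b; rewrite !mxE; ring.
apply/matrixP => a b; rewrite /tperm_mx !mxE.
have ji : (j == i) = false by rewrite eq_sym (negbTE ij).
by case: tpermP => [->|->|/eqP/negbTE ai /eqP/negbTE aj];
  rewrite !(eq_sym b) ?eqxx ?ai ?aj ?(negbTE ij) ?ji /=; ring.
Qed.

Lemma rot_flip i j : i != j -> rot j i *m flip i = tperm_mx i j.
Proof.
move=> ij; have ji : j != i by rewrite eq_sym.
have h1 : dl i i *m dl i i = dl i i by exact: mul_delta_mx.
have h2 : dl j j *m dl i i = 0 by exact: mul_delta_mx_0.
have h3 : dl j i *m dl i i = dl j i by exact: mul_delta_mx.
have h4 : dl i j *m dl i i = 0 by exact: mul_delta_mx_0.
have h5 : rot j i *m flip i = flip i *m rot i j.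
  rewrite /flip mulmxBr mulmx1 -scalemxAr /rot.
  rewrite mulmxBl mul1mx -scalemxAl.
  have g2 : dl i i *m dl j j = 0 by exact: mul_delta_mx_0.
  have g3 : dl i i *m dl i j = dl i j by exact: mul_delta_mx.
  have g4 : dl i i *m dl j i = 0 by exact: mul_delta_mx_0.
  rewrite !(mulmxDl, mulmxDr, mulNmx, mulmxN, mulmx1, mul1mx, h1, h2, h3, h4, g2, g3, g4).
  by apply/matrixP => a b; rewrite !mxE; ring.
by rewrite h5 flip_rot.
Qed.

(** Two distinct reflections make a half turn, the square of a quarter turn. *)
Lemma conn_flips i j : conn (flip i *m flip j).
Proof.
have [->|ij] := eqVneq i j; first by rewrite flipK; exact: conn1.
suff -> : flip i *m flip j = rot i j *m rot i j by apply: conn_mul; exact: conn_rot.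
have ji : j != i by rewrite eq_sym.
have h1 : dl i i *m dl i i = dl i i by exact: mul_delta_mx.
have h2 : dl i i *m dl j j = 0 by exact: mul_delta_mx_0.
have h3 : dl i i *m dl i j = dl i j by exact: mul_delta_mx.
have h4 : dl i i *m dl j i = 0 by exact: mul_delta_mx_0.
have k1 : dl j j *m dl j j = dl j j by exact: mul_delta_mx.
have k2 : dl j j *m dl i i = 0 by exact: mul_delta_mx_0.
have k3 : dl j j *m dl j i = dl j i by exact: mul_delta_mx.
have k4 : dl j j *m dl i j = 0 by exact: mul_delta_mx_0.
have m1 : dl i j *m dl i i = 0 by exact: mul_delta_mx_0.
have m2 : dl i j *m dl j j = dl i j by exact: mul_delta_mx.
have m3 : dl i j *m dl i j = 0 by exact: mul_delta_mx_0.
have m4 : dl i j *m dl j i = dl i i by exact: mul_delta_mx.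
have l1 : dl j i *m dl j j = 0 by exact: mul_delta_mx_0.
have l2 : dl j i *m dl i i = dl j i by exact: mul_delta_mx.
have l3 : dl j i *m dl j i = 0 by exact: mul_delta_mx_0.
have l4 : dl j i *m dl i j = dl j j by exact: mul_delta_mx.
rewrite /flip /rot [LHS]mulmxBl [LHS]addrC -scalemxAl.
rewrite !(mulmxDl, mulmxDr, mulNmx, mulmxN, mulmx1, mul1mx, h1, h2, h3, h4, k1, k2, k3, k4,
  m1, m2, m3, m4, l1, l2, l3, l4) -?scalemxAr ?h2.
by apply/matrixP => a b; rewrite !mxE; ring.
Qed.

Let J := flip ord0.

(* Multiplying by the reflection [J] on the right repairs the sign of the
   determinant; [good] is the condition under which right factors preserve
   [semiconn]. *)
Definition semiconn x := conn x \/ conn (x *m J).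
Definition good x := semiconn x /\ semiconn (J *m x).

Lemma flip0K : J *m J = 1%:M. Proof. exact: flipK. Qed.

(** If it is [x *m J] that is connected, [x *m y] is written as [x *m J] times [J *m y]; this is why
    [good] also looks at [J *m x]. *)
Lemma semiconn_mul x y : semiconn x -> good y -> semiconn (x *m y).
Proof.
move=> [cx|cx] [sy sJy].
  case: sy => cy; [left|right]; last rewrite -mulmxA; exact: conn_mul.
have -> : x *m y = (x *m J) *m (J *m y).
  by rewrite mulmxA -(mulmxA x) flip0K mulmx1.
by case: sJy => cy; [left|right]; last rewrite -mulmxA; exact: conn_mul.
Qed.

Lemma good1 : good 1%:M.
Proof. by split; [left|rewrite mulmx1; right; rewrite flip0K]; exact: conn1. Qed.

Lemma good_mul x y : good x -> good y -> good (x *m y).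
Proof.
move=> [sx sJx] gy; split; first exact: semiconn_mul.
by rewrite mulmxA; exact: semiconn_mul.
Qed.

Lemma good_flip i : good (flip i).
Proof. by split; [right|left]; exact: conn_flips. Qed.

Lemma good_tperm i j : i != j -> good (tperm_mx i j).
Proof.
move=> ij; split.
  right; rewrite -(rot_flip ij) -mulmxA; apply: conn_mul; last exact: conn_flips.
  by apply: conn_rot; rewrite eq_sym.
left; rewrite -(flip_rot ij) mulmxA; apply: conn_mul; first exact: conn_flips.
exact: conn_rot.
Qed.

Lemma good_perm s : good (perm_mx s).
Proof.
have [ts -> ] := prod_tpermP s; elim: ts => [_|[i j] ts IH /= /andP[ij /IH h]].
  by rewrite big_nil perm_mx1; exact: good1.
rewrite big_cons perm_mxM; apply: good_mul => //; exact: good_tperm.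
Qed.

Definition sgn_at (i : 'I_n.+1) : 'rV[R]_n.+1 := \row_j (if j == i then -1 else 1).

Lemma flip_diag i : flip i = diag_mx (sgn_at i).
Proof.
apply/matrixP => a b; rewrite !mxE; have [<-|ab] := eqVneq a b.
  by rewrite mulr1n andbb; case: (a == i) => /=; ring.
have -> : (a == i) && (b == i) = false.
  by apply/negP => /andP[/eqP ai /eqP bi]; rewrite ai bi eqxx in ab.
by rewrite /=; ring.
Qed.

Lemma sgn_at_sqr i j : sgn_at i 0 j * sgn_at i 0 j = 1.
Proof. by rewrite mxE; case: ifP => _; ring. Qed.

Lemma sgn_at_neq0 i j : sgn_at i 0 j != 0.
Proof. by apply/eqP => h; have := sgn_at_sqr i j; rewrite h mul0r => /esym/eqP; rewrite oner_eq0. Qed.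

Lemma det_flip i : \det (flip i) = -1.
Proof.
rewrite flip_diag det_diag (bigD1 i) //= mxE eqxx big1 ?mulr1 // => j ji.
by rewrite mxE (negbTE ji).
Qed.

(** Induction on the number of negative entries: a reflection on the right makes one of them
    positive. *)
Lemma semiconn_diag (d : 'rV[R]_n.+1) : (forall i, d 0 i != 0) -> semiconn (diag_mx d).
Proof.
have [k] := ubnP #|[pred i | d 0 i < 0]|; elim: k d => // k IH d dk d0.
have [i di|dpos] := pickP (fun i => d 0 i < 0); last first.
  by left; apply: conn_diag => i; rewrite lt_def d0 leNgt dpos.
pose d' := \row_j (d 0 j * sgn_at i 0 j).
have -> : diag_mx d = diag_mx d' *m flip i.
  rewrite flip_diag mulmx_diag; congr diag_mx; apply/rowP => j.
  by rewrite [RHS]mxE [d' 0 j]mxE -mulrA sgn_at_sqr mulr1.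
have d'E j : d' 0 j = if j == i then - d 0 j else d 0 j.
  by rewrite mxE [sgn_at _ _ _]mxE; case: ifP => _; rewrite ?mulrN1 ?mulr1.
apply: semiconn_mul (good_flip i); apply: IH => [|j]; last first.
  by rewrite d'E; case: ifP; rewrite ?oppr_eq0.
rewrite ltnS in dk; apply: leq_trans dk; apply: proper_card; apply/properP; split.
  by apply/fintype.subsetP => j; rewrite !inE d'E; case: eqP => [->|//]; rewrite di.
by exists i; rewrite inE ?di // d'E eqxx oppr_lt0 -leNgt ltW.
Qed.

Lemma good_diag (d : 'rV[R]_n.+1) : (forall i, d 0 i != 0) -> good (diag_mx d).
Proof.
move=> d0; split; first exact: semiconn_diag.
rewrite /J flip_diag mulmx_diag; apply: semiconn_diag => i.
by rewrite mxE mulf_neq0 // sgn_at_neq0.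
Qed.

Lemma flip_conj i x a b : (flip i *m x *m flip i) a b = sgn_at i 0 a * x a b * sgn_at i 0 b.
Proof. by rewrite flip_diag mul_mx_diag mul_diag_mx !mxE. Qed.

(** Conjugation by a diagonal reflection preserves unit lower triangular matrices, so [J *m x *m J]
    is of the same kind. *)
Lemma good_lower x : (forall i j : 'I_n.+1, (i <= j)%N -> x i j = (i == j)%:R) -> good x.
Proof.
move=> h; split; [left; exact: conn_lower|right; apply: conn_lower => i j ij].
rewrite flip_conj h //; have [->|_] := eqVneq i j; last by rewrite mulr0 mul0r.
by rewrite mulr1 sgn_at_sqr.
Qed.

Lemma good_upper x : (forall i j : 'I_n.+1, (j <= i)%N -> x i j = (i == j)%:R) -> good x.
Proof.
move=> h; split; [left; exact: conn_upper|right; apply: conn_upper => i j ij].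
rewrite flip_conj h //; have [->|_] := eqVneq i j; last by rewrite mulr0 mul0r.
by rewrite mulr1 sgn_at_sqr.
Qed.

(** In the pivoted LU decomposition the signs sit in the permutation and in the diagonal of [U];
    both are good factors. *)
Lemma good_unit x : x \in unitmx -> good x.
Proof.
move=> ux; case E : (cormen_lup x) => [[P L] U].
have := cormen_lup_perm x; have := cormen_lup_correct x; have := cormen_lup_detL x.
have := cormen_lup_lower x; have := cormen_lup_upper x; rewrite E /= => hU hL dL e /is_perm_mxP[s Ps].
have {}e : P *m x = L *m U by exact: e.
have xE : x = perm_mx s^-1%g *m L *m U.
  by rewrite -mulmxA -e Ps mulmxA -perm_mxM mulVg perm_mx1 mul1mx.
have dU : \det U != 0.
  have := ux; rewrite xE unitmxE unitfE !det_mulmx => h; apply: contraNneq h => ->.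
  by rewrite mulr0.
have U0 i : U i i != 0.
  move: dU; rewrite -det_tr det_trig; last first.
    by apply/is_trig_mxP => a b ab; rewrite mxE hU.
  by move/prodf_neq0 => /(_ i isT); rewrite mxE.
rewrite xE; apply: good_mul; first apply: good_mul; first exact: good_perm.
  by apply: good_lower => i j ij; exact: hL.
(* The diagonal of [U], possibly with negative entries, is split off to leave a unit upper
   triangular factor. *)
pose d : 'rV[R]_n.+1 := \row_i U i i; pose d' : 'rV[R]_n.+1 := \row_i (U i i)^-1.
have -> : U = diag_mx d *m (diag_mx d' *m U).
  rewrite mulmxA mulmx_diag -[LHS]mul1mx; congr (_ *m _); apply/matrixP => i j.
  by rewrite !mxE divff.
apply: good_mul; first by apply: good_diag => i; rewrite mxE.
apply: good_upper => i j ji; rewrite mul_diag_mx mxE mxE.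
move: ji; rewrite leq_eqVlt => /orP[/eqP/val_inj->|ji]; first by rewrite eqxx mulVf.
by rewrite (hU i j ji) mulr0 -val_eqE /= gtn_eqF.
Qed.

(** [J] has determinant -1, so the alternative that [x *m J] is connected contradicts
    [0 < \det x]. *)
Lemma GLplus_conn x : 0 < \det x -> conn x.
Proof.
move=> dx; have ux : x \in unitmx by rewrite unitmxE unitfE gt_eqF.
have [[//|[d _]] _] := good_unit ux.
by move: d; rewrite det_mulmx det_flip mulrN1 oppr_gt0 ltNge ltW.
Qed.

Lemma GLplus_reach x y : 0 < \det x -> 0 < \det y -> exists L : R, reach g L x y.
Proof.
move=> dx dy; have ux : x \in unitmx by rewrite unitmxE unitfE gt_eqF.
have [|_ [L rL]] := @GLplus_conn (invmx x *m y).
  by rewrite det_mulmx det_inv mulr_gt0 // invr_gt0.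
by exists L; have := reach_translate ux rL; rewrite mulmx1 mulKVmx.
Qed.

End GLplus_connected.

(** * Small loops *)

Section affine_curves.
Variables (R : realType) (n : nat).
Implicit Types A V : 'M[R]_n.

Lemma affine_quotient A V (u v a b t : R) (Y : R -> 'M[R]_n) : a < b ->
  (forall s, s \in `[a, b] -> Y s = A + (u + v * s) *: V) ->
  t \in `[a, b] ->
  (s - t)^-1 *: (Y s - Y t) @[s --> within `[a, b] t^'] --> v *: V.
Proof.
move=> ab hY tab; apply/cvgrPdist_le => e e0.
apply: (near_within_dnbhs ltr01) => s sab st _.
rewrite !hY // opprD addrACA subrr add0r -scalerBl scalerA.
have -> : (s - t)^-1 * (u + v * s - (u + v * t)) = v.
  by field; rewrite subr_eq0.
by rewrite subrr normr0 ltW.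
Qed.

End affine_curves.

Section loops.
Variables (R : realType) (n : nat) (g : inner_norm R n.+1).
Local Notation nrm := (nrm g).
Local Notation mu := (@lebesgue_measure R).

(* A closed curve of 1 x 1 matrices has to turn back, hence the corner at [0]. *)
Definition small_loop (A : 'M[R]_n.+1) (e t : R) : 'M[R]_n.+1 :=
  (1 + e * (1 - `|t|)) *: A.

(** Along multiples of [A] the left-translated velocity is a multiple of 1, of norm at most
    [e * nrm 1%:M], and the parameter interval has length 2. With [e] arbitrary, the distance from
    [A] to itself is 0. *)
Lemma small_loop_admissible (A : 'M[R]_n.+1) (e : R) : 0 < e -> \det A != 0 ->
  admissible A A (-1) 1 (small_loop A e) /\
  (\int[mu]_(t in `[(-1)%R, 1%R]) (speed g (small_loop A e) t)%:E <= (2 * (e * nrm 1%:M))%:E)%E.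
Proof.
move=> e0 dA; have uA : A \in unitmx by rewrite unitmxE unitfE.
have A0 : A != 0.
  by apply: contraNneq dA => ->; rewrite det0.
pose Y := small_loop A e; rewrite -/Y.
have k0 (t : R) : t \in `[-1, 1] -> 1 <= 1 + e * (1 - `|t|).
  rewrite in_itv /= -ler_norml => t1.
  by rewrite lerDl mulr_ge0 ?subr_ge0 // ltW.
have uY t : t \in `[-1, 1] -> Y t \in unitmx.
  move=> /k0 h; rewrite /Y /small_loop unitmxE detZ unitfE mulf_neq0 // expf_neq0 //.
  by rewrite gt_eqF // (lt_le_trans ltr01).
have cY : continuous Y.
  move=> t; apply: cvgZl; apply: cvgD; first exact: cvg_cst.
  apply: cvgM; first exact: cvg_cst; apply: cvgB; first exact: cvg_cst.
  exact: cvg_norm.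
have sub1 (t : R) : t \in `[-1, 0] -> t \in `[-1, 1].
  by rewrite !in_itv /= => /andP[-> t0]; rewrite (le_trans t0).
have sub2 (t : R) : t \in `[0, 1] -> t \in `[-1, 1].
  by rewrite !in_itv /= => /andP[t0 ->]; rewrite andbT (le_trans _ t0).
have D1 t : t \in `[-1, 0] ->
    (s - t)^-1 *: (Y s - Y t) @[s --> within `[-1, 0] t^'] --> e *: A.
  apply: (@affine_quotient _ _ 0 _ (1 + e) e) => [|s]; first by lra.
  rewrite in_itv /= => /andP[_ s0]; rewrite /Y /small_loop ler0_norm // add0r.
  by congr (_ *: _); ring.
have D2 t : t \in `[0, 1] ->
    (s - t)^-1 *: (Y s - Y t) @[s --> within `[0, 1] t^'] --> - e *: A.
  apply: (@affine_quotient _ _ 0 _ (1 + e) (- e)) => [|s]; first by lra.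
  rewrite in_itv /= => /andP[s0 _]; rewrite /Y /small_loop ger0_norm // add0r.
  by congr (_ *: _); ring.
have nz (k : R) : k != 0 -> k *: A != 0 by move=> ?; rewrite scaler_eq0 negb_or; apply/andP.
have bd (k t : R) : `|k| = e -> t \in `[-1, 1] -> nrm (invmx (Y t) *m (k *: A)) <= e * nrm 1%:M.
  move=> ke tab; have h := k0 t tab; have h0 := lt_le_trans ltr01 h.
  have -> : invmx (Y t) *m (k *: A) = (k / (1 + e * (1 - `|t|))) *: 1%:M.
    apply: (can_inj (mulKmx (uY t tab))); rewrite mulKVmx ?uY //.
    rewrite -scalemxAr mulmx1 /Y /small_loop scalerA divfK ?gt_eqF //.
  rewrite nrmZ normrM ke ler_wpM2r ?nrm_ge0 // normfV (gtr0_norm h0).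
  by rewrite ler_pdivrMr // ler_peMr // ltW.
have c1 (D : 'M[R]_n.+1) (a b : R) : {within `[a, b], continuous (fun=> D)}.
  by apply: continuous_subspaceT => x; exact: cvg_cst.
split.
  split.
  - lra.
  - by rewrite /Y /small_loop normrN1 normr1 subrr mulr0 addr0 scale1r.
  - by move=> t /uY; rewrite unitmxE unitfE.
  - exact: continuous_subspaceT.
  exists [:: 0; 1]; first by split=> //=; rewrite ltrN10 ltr01.
  case=> [_|[_|//]] /=.
    by exists (fun=> e *: A); split => // t _; apply: nz; rewrite gt_eqF.
  by exists (fun=> - e *: A); split => // t _; apply: nz; rewrite oppr_eq0 gt_eqF.
have [|||||||m1 i1] := @regular_length_le _ _ g (-1) 0 (e * nrm 1%:M) Y (fun=> e *: A).
- lra.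
- by move=> t /sub1 /uY.
- exact: continuous_subspaceT.
- exact: D1.
- exact: c1.
- by move=> t _; apply: nz; rewrite gt_eqF.
- move=> t /andP[h1 h2]; apply: bd; first by rewrite gtr0_norm.
  by apply: sub1; rewrite in_itv /= !ltW.
have [|||||||m2 i2] := @regular_length_le _ _ g 0 1 (e * nrm 1%:M) Y (fun=> - e *: A).
- lra.
- by move=> t /sub2 /uY.
- exact: continuous_subspaceT.
- exact: D2.
- exact: c1.
- by move=> t _; apply: nz; rewrite oppr_eq0 gt_eqF.
- move=> t /andP[h1 h2]; apply: bd; first by rewrite normrN gtr0_norm.
  by apply: sub2; rewrite in_itv /= !ltW.
have f0 t : (0 <= (speed g Y t)%:E)%E by rewrite lee_fin nrm_ge0.
have [_ ->] := integral_itv_cat (lerN10 R) ler01 f0 m1 m2.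
apply: (le_trans (leeD i1 i2)); rewrite -EFinD lee_fin; lra.
Qed.

End loops.

(* A nowhere vanishing derivative forces positive length, so for A = B the
   infimum 0 is not attained among admissible curves; there the minimizer is
   the constant curve. *)
Theorem proposition4p6 (R : realType) (n : nat) (mu muc kappa : R)
    (A B : 'M[R]_n) :
  (1 <= n)%N -> 0 < mu -> 0 < muc -> 0 < kappa ->
  GLplus A -> GLplus B ->
  (A <> B ->
    exists a b X, admissible A B a b X /\
      curve_length mu muc kappa a b X = geod_dist mu muc kappa A B) /\
  (A = B ->
    forall a b : R, a < b ->
      curve_length mu muc kappa a b (fun=> A) = geod_dist mu muc kappa A B).
Proof.
case: n A B => // n A B n1 mu0 muc0 kappa0 dA dB.
have [g gE] := iso_inner_norm_exists n1 mu0 muc0 kappa0.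
have lengthE a b (X : R -> 'M[R]_n.+1) : curve_length mu muc kappa a b X =
    (\int[lebesgue_measure]_(t in `[a, b]) (speed g X t)%:E)%E.
  by rewrite /curve_length /riem_metric -gE.
have dist_le a b (X : R -> 'M[R]_n.+1) : admissible A B a b X ->
    (geod_dist mu muc kappa A B <= curve_length mu muc kappa a b X)%E.
  by move=> aX; apply: ereal_inf_lbound; exists a, b, X.
split=> [AB|AB a b ab].
  have [L0 r0] := GLplus_reach g dA dB.
  have [l rl lmin] := reach_min r0.
  (* Length 0 would give [step A B = 0], hence [A = B]; a positive [l] makes [[0, l]] a genuine
     parameter interval. *)
  have l0 : 0 < l.
    rewrite lt_def (reach_ge0 rl) andbT; apply/negP => /eqP l0; apply: AB.
    have uA : A \in unitmx by rewrite unitmxE unitfE gt_eqF.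
    apply: (step_eq0 (g := g) uA); apply/eqP; rewrite eq_le step_ge0 andbT.
    have := reach_growth rl; rewrite l0 mulr0 expR0 gerDl.
    by rewrite pmulr_rle0 // icst_gt0.
  have [X [X0 Xl uX gX]] := reach_curve (ltW l0) rl.
  have mX : minimal_curve g l X by split => //; rewrite X0 Xl.
  have aX : admissible A B 0 l X by rewrite -X0 -Xl; exact: minimal_admissible mX.
  exists 0, l, X; split=> //; apply/eqP; rewrite eq_le dist_le // andbT.
  rewrite lengthE [X in (X <= _)%E](minimal_length l0 mX).
  (* The length of any competitor is reachable, hence at least [l]. *)
  apply: le_ereal_inf_tmp => _ [a [b [Y [aY ->]]]].
  have [L hL rL] := admissible_reach g aY.
  by rewrite lengthE hL lee_fin lmin.
have -> : curve_length mu muc kappa a b (fun=> A) = 0%E.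
  rewrite lengthE; apply: integral0_eq => t _.
  by rewrite /speed derive1_cst mulmx0 nrm0.
apply/eqP; rewrite eq_le; apply/andP; split.
  apply: le_ereal_inf_tmp => _ [a' [b' [Y [_ ->]]]].
  by rewrite lengthE; apply: integral_ge0 => t _; rewrite lee_fin nrm_ge0.
apply/lee_addgt0Pr => e e0; rewrite add0e.
(* The loop of parameter [e / k] has length at most [e]; the 1 keeps [k] positive. *)
pose k := 2 * (nrm g 1%:M + 1).
have k0 : 0 < k by rewrite mulr_gt0 // ltr_wpDl // nrm_ge0.
have dA0 : \det A != 0 by rewrite gt_eqF.
have [aY hY] := small_loop_admissible g (divr_gt0 e0 k0) dA0.
rewrite -AB in dist_le *.
apply: (le_trans (dist_le _ _ _ aY)); rewrite lengthE; apply: (le_trans hY).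
have q0 := divr_gt0 e0 k0.
have ek : e = e / k * (2 * (nrm g 1%:M + 1)) by rewrite divfK // gt_eqF.
by rewrite lee_fin [leRHS]ek; lra.
Qed.
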